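(* Achieving bound consistency (BC) for the constraint $\textsc{LotSizing}(X,I,Y,\mathit{Cp},\mathit{Ch},\mathit{Cs},C,data)$ can be done in pseudo-polynomial time, i.e. in time polynomial in the number of periods $T$ and the numerical values of the integers in the input (data and variable domains).
   Context: Data: $T\in\mathbb{N}$ and, for each $t\in\{1,\dots,T\}$, non-negative integers $p_t$ (unit production cost), $h_t$ (unit holding cost), $s_t$ (setup cost), $d_t$ (demand), $\underline{\alpha_t},\overline{\alpha_t}$ (minimal and maximal production), $\underline{\beta_t},\overline{\beta_t}$ (minimal and maximal ending inventory); $data$ denotes this collection. Variables: $X=\langle X_1,\dots,X_T\rangle$ and $I=\langle I_1,\dots,I_T\rangle$ with non-negative integer values, $Y=\langle Y_1,\dots,Y_T\rangle$ with values in $\{0,1\}$, and non-negative integer cost variables $\mathit{Cp},\mathit{Ch},\mathit{Cs},C$. Each variable $V$ has a finite domain $D(V)$, with minimum $\underline{V}$ and maximum $\overline{V}$. By convention $I_0=0$ and $I_T=0$. The constraint $\textsc{LotSizing}(X,I,Y,\mathit{Cp},\mathit{Ch},\mathit{Cs},C,data)$ is satisfied by an assignment of these variables iff, for all $t=1,\dots,T$, $$I_{t-1}+X_t=d_t+I_t,\quad X_t\le\overline{\alpha_t}Y_t,\quad X_t\in\{\underline{\alpha_t},\dots,\overline{\alpha_t}\},\quad I_t\in\{\underline{\beta_t},\dots,\overline{\beta_t}\},\quad Y_t\in\{0,1\},$$ and $$\mathit{Cp}=\sum_{t=1}^Tp_tX_t,\quad \mathit{Ch}=\sum_{t=1}^Th_tI_t,\quad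 \mathit{Cs}=\sum_{t=1}^Ts_tY_t,\quad C=\mathit{Cp}+\mathit{Ch}+\mathit{Cs},$$ $$\mathit{Cp}\le\overline{\mathit{Cp}},\quad \mathit{Ch}\le\overline{\mathit{Ch}},\quad \mathit{Cs}\le\overline{\mathit{Cs}},\quad C\le\overline{C}.$$ Let $c$ be a constraint on variables $\langle V_1,\dots,V_n\rangle$. A bound support for $c$ is a tuple of integers $\langle v_1,\dots,v_n\rangle$ that satisfies $c$ and such that $\underline{V_i}\le v_i\le\overline{V_i}$ for each $i$. A variable $V_i$ is bound consistent for $c$ if both $\underline{V_i}$ and $\overline{V_i}$ belong to a bound support for $c$ (i.e. there are bound supports with $v_i=\underline{V_i}$ and with $v_i=\overline{V_i}$). The constraint $c$ is BC if all its variables are bound consistent. Achieving BC means computing from the given domains, by removing values that cannot belong to any bound-consistent reduction, the largest sub-domains for which the constraint is BC (or detecting that there are none). *)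

(* Defs.v *)
(* Mathematical Components, with finite sets of naturals from finmap. *)
From mathcomp Require Import all_boot finmap.

Set Implicit Arguments.
Unset Strict Implicit.
Unset Printing Implicit Defensive.

Local Open Scope fset_scope.
Local Open Scope nat_scope.

(** * Bound consistency *)

Section BoundConsistency.

Variable V : Type.

Definition domains := V -> {fset nat}.
Definition assignment := V -> nat.

(* The domains are an argument of a constraint because constraints such as
   LotSizing mention the current bounds of their variables. *)
Definition constraint := domains -> assignment -> Prop.

Definition elements (A : {fset nat}) : seq nat := sort leq (enum_fset A).

(* Both are 0 on the empty domain, which [bound_consistent] excludes. *)
Definition dom_min (A : {fset nat}) : nat := head 0 (elements A).
Definition dom_max (A : {fset nat}) : nat := last 0 (elements A).

Definition bound_support (c : constraint) (D : domains) (v : assignment) : Prop :=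
  c D v /\ forall x, dom_min (D x) <= v x <= dom_max (D x).

Definition bound_consistent (c : constraint) (D : domains) (x : V) : Prop :=
  [/\ D x != fset0,
      exists2 v, bound_support c D v & v x = dom_min (D x)
    & exists2 v, bound_support c D v & v x = dom_max (D x)].

Definition is_BC (c : constraint) (D : domains) : Prop :=
  forall x, bound_consistent c D x.

Definition subdomains (D' D : domains) : Prop := forall x, D' x `<=` D x.

(* [r] is a correct answer to the task of achieving BC for [c] from [D]:
   the largest BC sub-domains, or [None] when there are no BC sub-domains. *)
Definition achieves_BC (c : constraint) (D : domains) (r : option domains) : Prop :=
  match r with
  | Some D' =>
      [/\ subdomains D' D, is_BC c D'
        & forall E, subdomains E D -> is_BC c E -> subdomains E D']
  | None => forall E, subdomains E D -> ~ is_BC c E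
  end.

End BoundConsistency.

(** * The LotSizing constraint *)

(* Period t, for 1 <= t <= T, is represented by the ordinal t - 1 : 'I_T. *)
Record lot_data (T : nat) := LotData {
  unit_cost : 'I_T -> nat;
  holding_cost : 'I_T -> nat;
  setup_cost : 'I_T -> nat;
  demand : 'I_T -> nat;
  prod_min : 'I_T -> nat;
  prod_max : 'I_T -> nat;
  stock_min : 'I_T -> nat;
  stock_max : 'I_T -> nat
}.

Inductive var (T : nat) : Type :=
  | VX of 'I_T | VI of 'I_T | VY of 'I_T
  | VCp | VCh | VCs | VC.

Arguments VCp {T}.
Arguments VCh {T}.
Arguments VCs {T}.
Arguments VC {T}.

(* The inventory at the end of period k, for 0 <= k <= T, with I_0 = 0;
   since 'I_T is 0-based, for t : 'I_T [inventory v t] is the inventory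
   entering the period represented by t, and v (VI t) the one leaving it. *)
Definition inventory (T : nat) (v : var T -> nat) (k : nat) : nat :=
  if k is k'.+1 then (if insub k' is Some t then v (VI t) else 0) else 0.

Definition LotSizing (T : nat) (data : lot_data T) : constraint (var T) :=
  fun D v =>
  [/\ forall t : 'I_T,
        [/\ inventory v t + v (VX t) = demand data t + v (VI t),
            v (VX t) <= prod_max data t * v (VY t),
            prod_min data t <= v (VX t) <= prod_max data t,
            stock_min data t <= v (VI t) <= stock_max data t
          & v (VY t) = 0 \/ v (VY t) = 1],
      inventory v T = 0,
      [/\ v VCp = \sum_(t < T) unit_cost data t * v (VX t),
          v VCh = \sum_(t < T) holding_cost data t * v (VI t),
          v VCs = \sum_(t < T) setup_cost data t * v (VY t)
        & v VC = v VCp + v VCh + v VCs]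
    & [/\ v VCp <= dom_max (D VCp), v VCh <= dom_max (D VCh),
          v VCs <= dom_max (D VCs) & v VC <= dom_max (D VC)]].

(** * Model of computation

    Structured programs for a random-access machine over natural numbers, with
    finitely many registers and arrays per program and unit cost per operation.
    Arithmetic is limited to addition, truncated subtraction and comparison:
    without multiplication, a run of n steps only produces numbers at most 2^n
    times larger than those of the program and its input, so that unit-cost time
    is polynomially related to Turing machine time. *)

Inductive expr : Type :=
  | Const of nat
  | Reg of nat
  | Get of nat & expr
  | Add of expr & expr
  | Sub of expr & expr
  | Leq of expr & expr.

(* Conditions hold when they evaluate to a non-zero number. *)
Inductive cmd : Type :=
  | Skip
  | SetReg of nat & expr
  | Store of nat & expr & expr
  | Seq of cmd & cmd
  | If of expr & cmd & cmd
  | While of expr & cmd.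

Record state := State {
  regs : nat -> nat;
  arrays : nat -> nat -> nat
}.

Fixpoint eval (s : state) (e : expr) : nat :=
  match e with
  | Const n => n
  | Reg r => regs s r
  | Get a e1 => arrays s a (eval s e1)
  | Add e1 e2 => eval s e1 + eval s e2
  | Sub e1 e2 => eval s e1 - eval s e2
  | Leq e1 e2 => eval s e1 <= eval s e2
  end.

Fixpoint cost (e : expr) : nat :=
  match e with
  | Const _ | Reg _ => 1
  | Get _ e1 => (cost e1).+1
  | Add e1 e2 | Sub e1 e2 | Leq e1 e2 => (cost e1 + cost e2).+1
  end.

Definition set_reg (s : state) (r n : nat) : state :=
  State (fun r' => if r' == r then n else regs s r') (arrays s).

Definition set_cell (s : state) (a i n : nat) : state :=
  State (regs s)
    (fun a' i' => if (a' == a) && (i' == i) then n else arrays s a' i').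

(* [exec c s s' n]: started in state s, c terminates in state s' in time n. *)
Inductive exec : cmd -> state -> state -> nat -> Prop :=
  | ExecSkip s : exec Skip s s 1
  | ExecSetReg s r e :
      exec (SetReg r e) s (set_reg s r (eval s e)) (cost e).+1
  | ExecStore s a e1 e2 :
      exec (Store a e1 e2) s (set_cell s a (eval s e1) (eval s e2))
           (cost e1 + cost e2).+1
  | ExecSeq c1 c2 s1 s2 s3 n1 n2 :
      exec c1 s1 s2 n1 -> exec c2 s2 s3 n2 ->
      exec (Seq c1 c2) s1 s3 (n1 + n2)
  | ExecIfTrue e c1 c2 s s' n :
      eval s e != 0 -> exec c1 s s' n ->
      exec (If e c1 c2) s s' ((cost e).+1 + n)
  | ExecIfFalse e c1 c2 s s' n :
      eval s e = 0 -> exec c2 s s' n ->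
      exec (If e c1 c2) s s' ((cost e).+1 + n)
  | ExecWhileTrue e c s1 s2 s3 n1 n2 :
      eval s1 e != 0 -> exec c s1 s2 n1 -> exec (While e c) s2 s3 n2 ->
      exec (While e c) s1 s3 ((cost e).+1 + n1 + n2)
  | ExecWhileFalse e c s :
      eval s e = 0 -> exec (While e c) s s (cost e).+1.

(* The input word is in array 0 and its length in register 0; everything else
   is 0.  The output word is read in array 1 and its length in register 1. *)
Definition input_state (w : seq nat) : state :=
  State (fun r => if r == 0 then size w else 0)
        (fun a i => if a == 0 then nth 0 w i else 0).

Definition output_word (s : state) : seq nat := mkseq (arrays s 1) (regs s 1).

Definition computes_within (c : cmd) (input output : seq nat) (bound : nat) : Prop :=
  exists s n, [/\ exec c (input_state input) s n,
                  output_word s = output & n <= bound].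

(** * Encoding of inputs and outputs *)

Definition all_vars (T : nat) : seq (var T) :=
  [seq VX t | t <- enum 'I_T] ++ [seq VI t | t <- enum 'I_T] ++
  [seq VY t | t <- enum 'I_T] ++ [:: VCp; VCh; VCs; VC].

Definition data_values (T : nat) (data : lot_data T) : seq nat :=
  flatten [seq [:: unit_cost data t; holding_cost data t; setup_cost data t;
                   demand data t; prod_min data t; prod_max data t;
                   stock_min data t; stock_max data t] | t <- enum 'I_T].

Definition domain_values (T : nat) (D : domains (var T)) : seq nat :=
  flatten [seq elements (D x) | x <- all_vars T].

(* Each domain is listed in increasing order, preceded by its cardinality. *)
Definition encode_domains (T : nat) (D : domains (var T)) : seq nat :=
  flatten [seq size (elements (D x)) :: elements (D x) | x <- all_vars T].

Definition encode_input (T : nat) (data : lot_data T) (D : domains (var T)) :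
    seq nat :=
  T :: data_values data ++ encode_domains D.

Definition encode_result (T : nat) (r : option (domains (var T))) : seq nat :=
  if r is Some D then 1 :: encode_domains D else [:: 0].

Definition max_value (T : nat) (data : lot_data T) (D : domains (var T)) : nat :=
  \max_(n <- data_values data ++ domain_values D) n.

(* Main.v *)
Require Import Defs.
From mathcomp Require Import all_boot finmap.
From mathcomp Require Import zify.

Set Implicit Arguments.
Unset Strict Implicit.
Unset Printing Implicit Defensive.

Local Open Scope fset_scope.
Local Open Scope nat_scope.

(** The largest BC sub-domains are found by narrowing a box of candidate values.
    If [E] is BC and contained in [D], the extreme values of each [E x] belong to
    bound supports, and these lie in the hull of [E].  So, as long as a box
    contains the hull of [E], an end of the box that is missing from its domain,
    or that no solution inside the box takes, is not an extreme value of [E] and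
    can be discarded ([encloses_low], [encloses_high]).  When no end can be
    discarded, cutting [D] down to the box gives BC domains that contain every
    such [E] ([stable_achieves_BC]); when the box becomes empty there is no such
    [E] ([empty_achieves_BC]).  Every round of narrowing discards a value unless
    the box is stable, so polynomially many rounds suffice ([rounds_result]).

    Whether some solution inside the box gives a variable a prescribed value is
    decided by dynamic programming: after [t] periods, the only thing that matters
    about the past is the current stock and the production, holding and setup
    costs paid so far, and the bounds of the box keep these four numbers below the
    base [b] ([reach_schedule], [schedule_reach], [feasibleP]).  The table of
    reachable states has at most [b ^ 5] cells: this is where pseudo-polynomial
    time comes from.

    The algorithm has to be a program of the random-access machine together with
    a bound on its running time.  It is written in a small language of nested
    expressions and loops in which no loop makes more than [N] turns, so that the
    running time is at most a polynomial in [N] read off from the shape of the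
    code ([wcost_poly]).  Binders are functions on a type of variables that is
    left open: taking numbers as variables gives the meaning of a program,
    taking registers gives its code, and the two agree ([compile_cmd_correct]).
    The base [b] is the sum of [n.+1] over the entries [n] of the input, which
    exceeds every entry and the length of the input; [N] is [b ^ 5].  Both are
    computed first, by expressions of the same language ([algorithm_steps]). *)

(** * Bounds of finite domains *)

Lemma mem_elements (A : {fset nat}) v : (v \in elements A) = (v \in A).
Proof. by rewrite mem_sort. Qed.

Lemma elements_sorted (A : {fset nat}) : sorted ltn (elements A).
Proof.
by rewrite ltn_sorted_uniq_leq sort_uniq fset_uniq sort_sorted //; apply: leq_total.
Qed.

Lemma elements_eq (A : {fset nat}) s :
  sorted ltn s -> s =i A -> elements A = s.
Proof.
move=> s_sorted sA; apply: (irr_sorted_eq ltn_trans ltnn) => //.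
  exact: elements_sorted.
by move=> v; rewrite mem_elements sA.
Qed.

Lemma dom_minP (A : {fset nat}) : A != fset0 ->
  dom_min A \in A /\ forall v, v \in A -> dom_min A <= v.
Proof.
rewrite /dom_min => A0; have := elements_sorted A; have := mem_elements A.
case: (elements A) => [|m s] memA.
  by case/fset0Pn: A0 => v; rewrite -memA.
rewrite /= (path_sortedE ltn_trans) => /andP [/allP min_m _].
split=> [|v]; first by rewrite -memA mem_head.
by rewrite -memA inE => /predU1P [->//|/min_m /ltnW].
Qed.

Lemma dom_maxP (A : {fset nat}) : A != fset0 ->
  dom_max A \in A /\ forall v, v \in A -> v <= dom_max A.
Proof.
rewrite /dom_max => A0; have := elements_sorted A; have := mem_elements A.
case/lastP: (elements A) => [|s m] memA.
  by case/fset0Pn: A0 => v; rewrite -memA.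
rewrite last_rcons (sorted_pairwise ltn_trans) pairwise_rcons.
move=> /andP [/allP max_m _].
split=> [|v]; first by rewrite -memA mem_rcons mem_head.
by rewrite -memA mem_rcons inE => /predU1P [->//|/max_m /ltnW].
Qed.

Lemma dom_min_eq (A : {fset nat}) m :
  m \in A -> (forall v, v \in A -> m <= v) -> dom_min A = m.
Proof.
move=> Am min_m; have A0 : A != fset0 by apply/fset0Pn; exists m.
have [Amin le_min] := dom_minP A0.
by apply/eqP; rewrite eqn_leq le_min // min_m.
Qed.

Lemma dom_max_eq (A : {fset nat}) m :
  m \in A -> (forall v, v \in A -> v <= m) -> dom_max A = m.
Proof.
move=> Am max_m; have A0 : A != fset0 by apply/fset0Pn; exists m.
have [Amax le_max] := dom_maxP A0.
by apply/eqP; rewrite eqn_leq le_max // max_m.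
Qed.

(** * Numbering of the variables *)

Definition vidx (T : nat) (x : var T) : nat :=
  match x with
  | VX t => t
  | VI t => T + t
  | VY t => T + T + t
  | VCp => T + T + T
  | VCh => T + T + T + 1
  | VCs => T + T + T + 2
  | VC => T + T + T + 3
  end.

(** The number of variables; [vidx] follows the order in which the domains are
    listed in the input. *)
Definition nvars (T : nat) : nat := T + T + T + 4.

Lemma vidx_lt T (x : var T) : vidx x < nvars T.
Proof. by rewrite /nvars; case: x => /= [t|t|t||||]; try have := ltn_ord t; lia. Qed.

Lemma vidx_inj T : injective (@vidx T).
Proof.
by move=> x y; case: x => [t|t|t||||]; case: y => [u|u|u||||] //= E;
   first [ by congr (_ _); apply: val_inj => /=; lia
         | exfalso; try have := ltn_ord t; try have := ltn_ord u; lia ].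
Qed.

Lemma map_vidx T : map (@vidx T) (all_vars T) = iota 0 (nvars T).
Proof.
have shift m (f : 'I_T -> var T) : (forall t, vidx (f t) = m + t) ->
    map (@vidx T) [seq f t | t <- enum 'I_T] = iota m T.
  move=> fE; rewrite -map_comp (eq_map (g := addn m \o val)) //.
  by rewrite map_comp val_enum_ord -iotaDl addn0.
rewrite /all_vars !map_cat /nvars !iotaD !add0n -!catA.
rewrite (shift 0) // (shift T) // (shift (T + T)) //.
by rewrite /= addn1 addn2 addn3.
Qed.

Lemma size_all_vars T : size (all_vars T) = nvars T.
Proof. by rewrite -(size_map (@vidx T)) map_vidx size_iota. Qed.

Definition nth_var (T x : nat) : var T := nth VC (all_vars T) x.

Lemma nth_varK T x : x < nvars T -> vidx (nth_var T x) = x.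
Proof.
move=> lt_x; rewrite -(nth_map _ 0 (@vidx T)) ?size_all_vars //.
by rewrite map_vidx nth_iota.
Qed.

Lemma vidxK T (x : var T) : nth_var T (vidx x) = x.
Proof. by apply: vidx_inj; rewrite nth_varK // vidx_lt. Qed.

(** * Narrowing the bounds *)

Section Narrowing.

Variables (T : nat) (data : lot_data T) (D : domains (var T)) (b : nat).
Hypothesis D_lt : forall x v, v \in D x -> v < b.

Definition production_plan (v : assignment (var T)) : Prop :=
  [/\ forall t : 'I_T,
        [/\ inventory v t + v (VX t) = demand data t + v (VI t),
            v (VX t) <= prod_max data t * v (VY t),
            prod_min data t <= v (VX t) <= prod_max data t,
            stock_min data t <= v (VI t) <= stock_max data t
          & v (VY t) = 0 \/ v (VY t) = 1],
      inventory v T = 0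
    & [/\ v VCp = \sum_(t < T) unit_cost data t * v (VX t),
          v VCh = \sum_(t < T) holding_cost data t * v (VI t),
          v VCs = \sum_(t < T) setup_cost data t * v (VY t)
        & v VC = v VCp + v VCh + v VCs]].

(** The upper end of the box is stored as its distance [up] to [b], so that
    discarding a value at either end is an increment, and the box that starts the
    search has all its entries equal to 0, as a fresh array has. *)
Definition in_box (lo up : nat -> nat) (v : assignment (var T)) : Prop :=
  forall x, lo (vidx x) <= v x /\ v x + up (vidx x) < b.

(** Membership in [D x] is included so that a value may be discarded either because
    no solution takes it or because it falls in a hole of the domain. *)
Definition supported (lo up : nat -> nat) (x : var T) (w : nat) : Prop :=
  w \in D x /\ exists v, [/\ in_box lo up v, production_plan v & v x = w].

Definition encloses (lo up : nat -> nat) : Prop :=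
  forall E, subdomains E D -> is_BC (LotSizing data) E ->
  forall x, lo (vidx x) <= dom_min (E x) /\ dom_max (E x) + up (vidx x) < b.

Definition stable (lo up : nat -> nat) : Prop :=
  forall x, supported lo up x (lo (vidx x))
         /\ supported lo up x (b.-1 - up (vidx x)).

Definition box_empty (lo up : nat -> nat) : Prop :=
  exists x : var T, b <= lo (vidx x) + up (vidx x).

Definition trim (lo up : nat -> nat) : domains (var T) :=
  fun x => [fset v in D x | (lo (vidx x) <= v) && (v + up (vidx x) < b)].

Lemma in_box_ext lo up lo' up' v :
  (forall x, x < nvars T -> lo x = lo' x /\ up x = up' x) ->
  in_box lo up v -> in_box lo' up' v.
Proof. by move=> eq_lu bv x; have [<- <-] := eq_lu _ (vidx_lt x). Qed.

Lemma supported_ext lo up lo' up' x w :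
  (forall x, x < nvars T -> lo x = lo' x /\ up x = up' x) ->
  supported lo up x w -> supported lo' up' x w.
Proof.
move=> eq_lu [Dw [v [bv pv vx]]]; split=> //; exists v; split=> //.
exact: in_box_ext bv.
Qed.

Lemma encloses_start : encloses (fun=> 0) (fun=> 0).
Proof.
move=> E sub_E bcE x; have [E0 _ _] := bcE x.
have [Emax _] := dom_maxP E0.
by split=> //; rewrite addn0; apply: (D_lt (x := x)); apply: (fsubsetP (sub_E x)).
Qed.

(** The constraint mentions the current maxima of the cost variables, but a bound
    support respects them anyway; what is left of it is a production plan. *)
Lemma support_in_box lo up E v :
  encloses lo up -> subdomains E D -> is_BC (LotSizing data) E ->
  bound_support (LotSizing data) E v -> in_box lo up v /\ production_plan v.
Proof.
move=> enc sub_E bcE [[L1 L2 L3 _] vE]; split=> // x.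
by have [] := enc _ sub_E bcE x; have /andP [] := vE x; lia.
Qed.

(** If [lo] were the minimum of [E x], the bound support of that minimum would be a
    solution inside the box. *)
Lemma encloses_low lo up E x :
  encloses lo up -> subdomains E D -> is_BC (LotSizing data) E ->
  ~ supported lo up x (lo (vidx x)) -> lo (vidx x) < dom_min (E x).
Proof.
move=> enc sub_E bcE nsup; have [le_lo _] := enc _ sub_E bcE x.
rewrite ltn_neqAle le_lo andbT; apply/eqP => eq_lo; apply: nsup.
have [E0 [v sv vx] _] := bcE x.
have [bv pv] := support_in_box enc sub_E bcE sv.
split; last by exists v; rewrite vx.
by rewrite eq_lo; apply: (fsubsetP (sub_E x)); case: (dom_minP E0).
Qed.

Lemma encloses_high lo up E x :
  encloses lo up -> subdomains E D -> is_BC (LotSizing data) E ->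
  ~ supported lo up x (b.-1 - up (vidx x)) ->
  dom_max (E x) + (up (vidx x)).+1 < b.
Proof.
move=> enc sub_E bcE nsup; have [_ lt_up] := enc _ sub_E bcE x.
rewrite ltn_neqAle addnS lt_up andbT; apply/eqP => eq_up; apply: nsup.
have -> : b.-1 - up (vidx x) = dom_max (E x) by lia.
have [E0 _ [v sv vx]] := bcE x.
have [bv pv] := support_in_box enc sub_E bcE sv.
split; last by exists v.
by apply: (fsubsetP (sub_E x)); case: (dom_maxP E0).
Qed.

(** In a stable box both ends of every interval belong to the domain, so they are
    the minimum and maximum of the trimmed domain, and the solutions that support
    them are bound supports. *)
Lemma stable_achieves_BC lo up :
  encloses lo up -> stable lo up ->
  achieves_BC (LotSizing data) D (Some (trim lo up)).
Proof.
move=> enc stab.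
have memE x v : (v \in trim lo up x)
    = (v \in D x) && ((lo (vidx x) <= v) && (v + up (vidx x) < b)).
  by rewrite !inE.
have box_ne (x : var T) : lo (vidx x) + up (vidx x) < b.
  by have [[_ [v [bv _ _]]] _] := stab x; have [] := bv x; lia.
have minE (x : var T) : dom_min (trim lo up x) = lo (vidx x).
  have [[Dlo _] _] := stab x.
  apply: dom_min_eq => [|v]; rewrite memE ?Dlo ?leqnn ?box_ne //.
  by case/and3P.
have maxE (x : var T) : dom_max (trim lo up x) = b.-1 - up (vidx x).
  have [_ [Dup _]] := stab x; have := box_ne x => ne.
  apply: dom_max_eq => [|v]; rewrite memE ?Dup /=; first by lia.
  by case/and3P; lia.
split.
- by move=> x; apply/fsubsetP => v; rewrite memE => /andP [].
- move=> x.
  have supE w : supported lo up x w ->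
      exists2 v, bound_support (LotSizing data) (trim lo up) v & v x = w.
    move=> [_ [v [bv [p1 p2 p3] vx]]]; exists v => //.
    have vmax y : v y <= dom_max (trim lo up y).
      by rewrite maxE; have [_] := bv y; lia.
    split; first by split=> //; split; apply: vmax.
    by move=> y; rewrite vmax minE andbT; have [] := bv y.
  have [sup_lo sup_up] := stab x; split.
  + apply/fset0Pn; exists (lo (vidx x)); rewrite memE leqnn box_ne /=.
    by rewrite andbT; case: sup_lo.
  + by rewrite minE; apply: supE.
  + by rewrite maxE; apply: supE.
- move=> E sub_E bcE x; apply/fsubsetP => v Ev; rewrite memE.
  rewrite (fsubsetP (sub_E x) _ Ev) /=; have [E0 _ _] := bcE x.
  have [lo_min max_up] := enc _ sub_E bcE x.
  have [_ /(_ _ Ev)] := dom_minP E0; have [_ /(_ _ Ev)] := dom_maxP E0.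
  by lia.
Qed.

Lemma empty_achieves_BC lo up :
  encloses lo up -> box_empty lo up -> achieves_BC (LotSizing data) D None.
Proof.
move=> enc [x empty] E sub_E bcE; have [lo_min max_up] := enc _ sub_E bcE x.
have [E0 _ _] := bcE x; have [/(proj2 (dom_maxP E0)) le_mm _] := dom_minP E0.
by lia.
Qed.

End Narrowing.

(** * Feasibility by dynamic programming *)

Section Reachability.

Variables (b : nat) (p h s d pmin pmax smin smax : nat -> nat).
Variables (okX okI okY : nat -> nat -> bool).
Hypothesis b_gt0 : 0 < b.
Hypothesis okX_lt : forall t v, okX t v -> v < b.
Hypothesis okI_lt : forall t v, okI t v -> v < b.

(** A period is described by its production [X], its setup decision [Y] and the
    stock [i] at its end. *)
Definition move (t X Y i : nat) : bool :=
  [&& okX t X, okI t i, okY t Y, X <= pmax t * Y,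
      pmin t <= X, X <= pmax t, smin t <= i & i <= smax t].

(** The state before the period is recovered by subtraction, which is truncated: it
    is meaningful only when every cost covers what the period spends.  The last
    condition keeps the former stock in the range of a digit in base [b]. *)
Definition pre (t X Y i a e c : nat) : bool :=
  [&& p t * X <= a, h t * i <= e, s t * Y <= c,
      X <= d t + i & d t + i - X < b].

(** Stock [i] and costs [a], [e], [c] of production, holding and setup can be
    reached at the end of the first [t] periods. *)
Fixpoint reach (t i a e c : nat) : bool :=
  if t is t'.+1 then
    has (fun X => has (fun Y =>
      [&& move t' X Y i, pre t' X Y i a e c &
          reach t' (d t' + i - X) (a - p t' * X) (e - h t' * i) (c - s t' * Y)])
      (iota 0 2)) (iota 0 b)
  else [&& i == 0, a == 0, e == 0 & c == 0].

Lemma reachS t i a e c : reach t.+1 i a e c =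
  has (fun X => has (fun Y =>
    [&& move t X Y i, pre t X Y i a e c &
        reach t (d t + i - X) (a - p t * X) (e - h t * i) (c - s t * Y)])
    (iota 0 2)) (iota 0 b).
Proof. by []. Qed.

Definition schedule (t : nat) (fX fI fY : nat -> nat) : Prop :=
  fI 0 = 0 /\ forall u, u < t ->
    [/\ move u (fX u) (fY u) (fI u.+1), fI u + fX u = d u + fI u.+1 & fY u < 2].

Definition spend (t : nat) (w f : nat -> nat) : nat := \sum_(u < t) w u * f u.

Lemma reach_schedule t i a e c : reach t i a e c ->
  exists fX fI fY, schedule t fX fI fY /\
    [/\ fI t = i, spend t p fX = a, spend t h (fun u => fI u.+1) = e
      & spend t s fY = c].
Proof.
elim: t i a e c => [|t IH] i a e c.
  case/and4P => /eqP-> /eqP-> /eqP-> /eqP->.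
  by exists (fun=> 0), (fun=> 0), (fun=> 0); rewrite /spend !big_ord0.
rewrite reachS => /hasP [X]; rewrite mem_iota => lt_X.
move=> /hasP [Y]; rewrite mem_iota => lt_Y.
case/and3P => mv /and5P [le_a le_e le_c le_X _].
case/IH => fX [fI [fY [[f0 sch] [fT Ea Ee Ec]]]].
pose put (f : nat -> nat) k v u := if u == k then v else f u.
exists (put fX t X), (put fI t.+1 i), (put fY t Y).
have putE f k v u : u != k -> put f k v u = f u by rewrite /put => /negbTE ->.
have put_eq f k v : put f k v k = v by rewrite /put eqxx.
split; first split.
- by rewrite putE.
- move=> u; rewrite ltnS leq_eqVlt => /predU1P [->|lt_ut].
    rewrite !put_eq putE ?neq_ltn ?ltnSn //.
    by rewrite fT subnK //; split=> //; lia.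
  have [mvu eq_u lt2] := sch u lt_ut.
  by rewrite !putE ?neq_ltn ?ltnS ?lt_ut // ltnW.
- split.
  + by rewrite put_eq.
  + rewrite /spend big_ord_recr /= put_eq -[RHS](subnK le_a) -Ea; congr (_ + _).
    by apply: eq_bigr => u _; rewrite putE // neq_ltn ltn_ord.
  + rewrite /spend big_ord_recr /= put_eq -[RHS](subnK le_e) -Ee; congr (_ + _).
    by apply: eq_bigr => u _; rewrite putE // neq_ltn ltnS ltn_ord.
  + rewrite /spend big_ord_recr /= put_eq -[RHS](subnK le_c) -Ec; congr (_ + _).
    by apply: eq_bigr => u _; rewrite putE // neq_ltn ltn_ord.
Qed.

Lemma schedule_reach t fX fI fY : schedule t fX fI fY ->
  reach t (fI t) (spend t p fX) (spend t h (fun u => fI u.+1)) (spend t s fY).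
Proof.
move=> [f0 sch]; elim: t sch => [|t IH] sch.
  by rewrite f0 /spend !big_ord0.
rewrite reachS.
have [mv eq_t lt2] := sch t (ltnSn t).
have lt_I : fI t < b.
  case: (t) sch => [|u] sch; first by rewrite f0.
  have [/and5P [_ okI_u _ _ _] _ _] := sch u (leqW (ltnSn u)).
  exact: okI_lt okI_u.
apply/hasP; exists (fX t).
  by case/and5P: mv => /okX_lt; rewrite mem_iota.
apply/hasP; exists (fY t); first by rewrite mem_iota.
have eq_I : d t + fI t.+1 - fX t = fI t by lia.
rewrite mv /pre eq_I lt_I /spend !big_ord_recr /= !leq_addl !addnK.
rewrite IH ?andbT /=; first by lia.
by move=> u lt_u; apply: sch; apply: ltnW.
Qed.

(** Position of a state in the table, with the period as leading digit: all the
    predecessors of a state lie before it, so the table can be filled in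
    increasing order of positions. *)
Definition code (t i a e c : nat) : nat := (((t * b + i) * b + a) * b + e) * b + c.

Definition at_code (f : nat -> nat -> nat -> nat -> nat -> bool) (q : nat) : bool :=
  let q1 := q %/ b in let q2 := q1 %/ b in let q3 := q2 %/ b in
  f (q3 %/ b) (q3 %% b) (q2 %% b) (q1 %% b) (q %% b).

Lemma at_codeE f t i a e c :
  i < b -> a < b -> e < b -> c < b -> at_code f (code t i a e c) = f t i a e c.
Proof.
move=> lt_i lt_a lt_e lt_c; rewrite /at_code /code.
have quo x y : y < b -> (x * b + y) %/ b = x.
  by move=> lt_y; rewrite divnMDl // divn_small // addn0.
have rem x y : y < b -> (x * b + y) %% b = y.
  by move=> lt_y; rewrite modnMDl modn_small.
by rewrite !quo // !rem.
Qed.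

Lemma code_lt t i a e c q :
  i < b -> a < b -> e < b -> c < b -> t < q %/ b %/ b %/ b %/ b ->
  code t i a e c < q.
Proof.
move=> lt_i lt_a lt_e lt_c; rewrite /code !leq_divRL //.
apply: leq_trans.
have S x y : y < b -> (x * b + y).+1 <= x.+1 * b by move=> lt_y; rewrite mulSn; lia.
have W x y : x < y -> x.+1 * b <= y * b by move=> lt_xy; rewrite leq_mul2r lt_xy orbT.
apply: leq_trans (S _ _ lt_c) (W _ _ _).
apply: leq_trans (S _ _ lt_e) (W _ _ _).
apply: leq_trans (S _ _ lt_a) (W _ _ _).
exact: S.
Qed.

Definition reach_step (R : nat -> nat) (t i a e c : nat) : bool :=
  (0 < t) && has (fun X => has (fun Y =>
      [&& move t.-1 X Y i, pre t.-1 X Y i a e c &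
          0 < R (code t.-1 (d t.-1 + i - X) (a - p t.-1 * X)
                   (e - h t.-1 * i) (c - s t.-1 * Y))])
      (iota 0 2)) (iota 0 b).

(** One turn of the loop that fills the table: a cell is correct when it is computed
    from correct cells at smaller positions.  The only state of period 0 is the
    one at position 0. *)
Lemma reach_stepE (R : nat -> nat) q :
  (forall q', q' < q -> R q' = at_code reach q') ->
  (q == 0) || at_code (reach_step R) q = at_code reach q.
Proof.
move=> Rq; rewrite /at_code.
set t := _ %/ _ %/ _ %/ _ %/ _ in Rq *.
set i := _ %/ _ %/ _ %/ _ %% _; set a := _ %/ _ %/ _ %% _.
set e := _ %/ _ %% _; set c := _ %% _.
have lt_a : a < b by rewrite ltn_mod.
have lt_e : e < b by rewrite ltn_mod.
have lt_c : c < b by rewrite ltn_mod.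
have code_q : q = code t i a e c by rewrite /code -!divn_eq.
case Et: t Rq code_q => [|t'] Rq code_q.
  by rewrite [q]code_q /reach_step /= orbF /code !mul0n !add0n !addn_eq0 !muln_eq0;
     rewrite !eqn0Ngt b_gt0 /= ?orbF ?andbA; lia.
have -> : q == 0 = false.
  by apply: contraTF isT => /eqP q0; move: Et; rewrite /t q0 !div0n.
rewrite /reach_step reachS.
apply: eq_has => X; apply: eq_has => Y.
apply: andb_id2l => mv; apply: andb_id2l => /and5P [_ _ _ _ lt_I].
have lt_a' := leq_ltn_trans (leq_subr (p t' * X) a) lt_a.
have lt_e' := leq_ltn_trans (leq_subr (h t' * i) e) lt_e.
have lt_c' := leq_ltn_trans (leq_subr (s t' * Y) c) lt_c.
by rewrite Rq ?at_codeE ?lt0b // code_lt // -/t Et.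
Qed.

End Reachability.

(** * Feasibility of a box *)

Section Feasible.

Variables (T b : nat) (W lo up : nat -> nat).

(** The eight data of period [t] follow the number of periods in the input, so [j]
    ranges from 1 to 8. *)
Definition field (j t : nat) : nat := W (t * 8 + j).

(** The box, with the variable of index [x] pinned to [w]; the order on booleans is
    implication. *)
Definition allowed (x w y v : nat) : bool :=
  [&& lo y <= v, v + up y < b & (y == x) <= (v == w)].

Definition box_reach (x w : nat) : nat -> nat -> nat -> nat -> nat -> bool :=
  reach b (field 1) (field 2) (field 3) (field 4) (field 5) (field 6)
    (field 7) (field 8) (allowed x w) (fun t => allowed x w (T + t))
    (fun t => allowed x w (T + T + t)).

Definition feasible (x w : nat) : bool :=
  has (fun a => has (fun e => has (fun c =>
    [&& box_reach x w T 0 a e c, allowed x w (T + T + T) a,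
        allowed x w (T + T + T + 1) e, allowed x w (T + T + T + 2) c
      & allowed x w (T + T + T + 3) (a + e + c)])
    (iota 0 b)) (iota 0 b)) (iota 0 b).

Variable data : lot_data T.
Hypothesis b_gt0 : 0 < b.
Hypothesis fieldE : forall t : 'I_T,
  [/\ field 1 t = unit_cost data t, field 2 t = holding_cost data t,
      field 3 t = setup_cost data t & field 4 t = demand data t] /\
  [/\ field 5 t = prod_min data t, field 6 t = prod_max data t,
      field 7 t = stock_min data t & field 8 t = stock_max data t].

Lemma allowed_lt x w y v : allowed x w y v -> v < b.
Proof. by case/and3P; lia. Qed.

Lemma allowedP (x : var T) w (v : assignment (var T)) :
  (forall y, allowed (vidx x) w (vidx y) (v y))
  <-> in_box b lo up v /\ v x = w.
Proof.
split=> [ok | [bv <-] y].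
  split=> [y|]; first by case/and3P: (ok y).
  by case/and3P: (ok x) => _ _; rewrite eqxx lt0b => /eqP.
have [lo_y up_y] := bv y; apply/and3P; split=> //.
by case: eqP => // /vidx_inj ->; rewrite eqxx.
Qed.

(** Solutions inside the box correspond to schedules of [T] periods that end with an
    empty stock and whose costs are allowed. *)
Lemma feasibleP (x : var T) w :
  reflect (exists v, [/\ in_box b lo up v, production_plan data v & v x = w])
          (feasible (vidx x) w).
Proof.
apply: (iffP idP) => [|[v [bv [pv v0 [Ep Eh Es Ec]] vx]]].
  case/hasP => a _ /hasP [e _] /hasP [c _].
  case/and5P => /reach_schedule [fX [fI [fY [[f0 sch] [fT Ea Ee Ec]]]]].
  move=> ok_a ok_e ok_c ok_ac.
  pose v (y : var T) := match y with
    | VX t => fX t | VI t => fI t.+1 | VY t => fY t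
    | VCp => a | VCh => e | VCs => c | VC => a + e + c end.
  have inv k : k <= T -> inventory v k = fI k.
    case: k => [|k] lt_k //=.
    by case: insubP => [u _ /= <- //|]; rewrite lt_k.
  have [|bv vx] := (allowedP x w v).1.
    case=> [t|t|t||||] //=; have [mv _ _] := sch _ (ltn_ord t).
    + by case/and5P: mv.
    + by case/and5P: mv.
    + by case/and5P: mv.
  exists v; split=> //; split.
  + move=> t; have [/and5P [_ _ _ le_mY]] := sch _ (ltn_ord t).
    have [[_ _ _ Ed] [E1 E2 E3 E4]] := fieldE t.
    rewrite -E1 -E2 -E3 -E4 -Ed.
    case/and4P => le1 le2 le3 le4 eq_t lt2.
    rewrite inv; last exact: ltnW.
    by rewrite /= eq_t le1 le2 le3 le4; split=> //; lia.
  + by rewrite inv.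
  + split=> //=; rewrite -?Ea -?Ee -?Ec; apply: eq_bigr => t _;
      by have [[F1 F2 F3 _] _] := fieldE t; rewrite ?F1 ?F2 ?F3.
pose lift (f : 'I_T -> nat) u := oapp f 0 (insub u).
have liftE f (t : 'I_T) : lift f t = f t by rewrite /lift valK.
pose fX := lift (fun t => v (VX t)); pose fY := lift (fun t => v (VY t)).
have invE (t : 'I_T) : inventory v t.+1 = v (VI t) by rewrite /= valK.
have ok : forall y, allowed (vidx x) w (vidx y) (v y) by apply/allowedP.
have := @schedule_reach b (field 1) (field 2) (field 3) (field 4) (field 5)
   (field 6) (field 7) (field 8) (allowed (vidx x) w)
   (fun t => allowed (vidx x) w (T + t))
   (fun t => allowed (vidx x) w (T + T + t)) b_gt0
   (fun t => @allowed_lt _ _ t) (fun t => @allowed_lt _ _ (T + t))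
   T fX (inventory v) fY.
rewrite v0.
have -> : spend T (field 1) fX = v VCp.
  by rewrite Ep; apply: eq_bigr => t _; rewrite /fX liftE; have [[->]] := fieldE t.
have -> : spend T (field 2) (fun u => inventory v u.+1) = v VCh.
  by rewrite Eh; apply: eq_bigr => t _; rewrite invE; have [[_ ->]] := fieldE t.
have -> : spend T (field 3) fY = v VCs.
  by rewrite Es; apply: eq_bigr => t _; rewrite /fY liftE; have [[_ _ ->]] := fieldE t.
move=> r; apply/hasP; exists (v VCp); first by rewrite mem_iota (allowed_lt (ok VCp)).
apply/hasP; exists (v VCh); first by rewrite mem_iota (allowed_lt (ok VCh)).
apply/hasP; exists (v VCs); first by rewrite mem_iota (allowed_lt (ok VCs)).
have := (ok VCp, ok VCh, ok VCs, ok VC); rewrite /= Ec => -[[[-> ->] ->] ->].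
rewrite !andbT; apply: r; split=> // u lt_u.
have -> : u = Ordinal lt_u :> nat by [].
have [bal le_mY /andP [le1 le2] /andP [le3 le4] Y01] := pv (Ordinal lt_u).
have := (ok (VX (Ordinal lt_u)), ok (VI (Ordinal lt_u)), ok (VY (Ordinal lt_u))).
have [[_ _ _ Ed] [E1 E2 E3 E4]] := fieldE (Ordinal lt_u).
move=> [[okX okI] okY]; rewrite /move /fX /fY !liftE invE E1 E2 E3 E4 Ed.
rewrite okX okI okY le1 le2 le3 le4 le_mY; split=> //.
by case: Y01 => ->.
Qed.

End Feasible.

(** * Running time of programs whose loops are short *)

(** Bounds the running time of [c] in every execution in which no loop makes more
    than [M] turns. *)
Fixpoint wcost (M : nat) (c : cmd) : nat :=
  match c with
  | Skip => 1
  | SetReg _ e => (cost e).+1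
  | Store _ e1 e2 => (cost e1 + cost e2).+1
  | Seq c1 c2 => wcost M c1 + wcost M c2
  | If e c1 c2 => (cost e).+1 + (wcost M c1 + wcost M c2)
  | While e c1 => M.+1 * ((cost e).+1 + wcost M c1)
  end.

(** The exponent is the number of loops in the program. *)
Lemma wcost_poly c : exists a k, forall M, wcost M c <= a * M.+1 ^ k.
Proof.
have E p q M : p <= p * M.+1 ^ q by rewrite leq_pmulr // expn_gt0.
have W p q q' M : p * M.+1 ^ q <= p * M.+1 ^ (q + q').
  by rewrite leq_mul2l leq_pexp2l ?leq_addr ?orbT.
elim: c => [|r e|i e1 e2|c1 [a1 [k1 H1]] c2 [a2 [k2 H2]]
    |e c1 [a1 [k1 H1]] c2 [a2 [k2 H2]]|e c1 [a1 [k1 H1]]] /=.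
- by exists 1, 0.
- by exists (cost e).+1, 0.
- by exists (cost e1 + cost e2).+1, 0.
- exists (a1 + a2), (k1 + k2) => M; rewrite mulnDl leq_add //.
    exact: leq_trans (H1 M) (W _ _ _ _).
  by rewrite (addnC k1); apply: leq_trans (H2 M) (W _ _ _ _).
- exists ((cost e).+1 + (a1 + a2)), (k1 + k2) => M.
  rewrite !mulnDl !leq_add //.
    exact: leq_trans (H1 M) (W _ _ _ _).
  by rewrite (addnC k1); apply: leq_trans (H2 M) (W _ _ _ _).
exists ((cost e).+1 + a1), k1.+1 => M.
rewrite expnS mulnCA leq_mul2l mulnDl leq_add ?orbT //.
Qed.

Definition steps (M : nat) (c : cmd) (s : state) (Q : state -> Prop) : Prop :=
  exists s' n, [/\ exec c s s' n, n <= wcost M c & Q s'].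

Lemma steps_weaken M c s (P Q : state -> Prop) :
  (forall s', P s' -> Q s') -> steps M c s P -> steps M c s Q.
Proof. by move=> PQ [s' [n [ex le_n /PQ]]]; exists s', n. Qed.

Lemma steps_set M r e s (Q : state -> Prop) :
  Q (set_reg s r (eval s e)) -> steps M (SetReg r e) s Q.
Proof. by move=> Qs; exists (set_reg s r (eval s e)), (cost e).+1; split=> //; constructor. Qed.

Lemma steps_store M a e1 e2 s (Q : state -> Prop) :
  Q (set_cell s a (eval s e1) (eval s e2)) -> steps M (Store a e1 e2) s Q.
Proof.
move=> Qs; exists (set_cell s a (eval s e1) (eval s e2)), (cost e1 + cost e2).+1.
by split=> //; constructor.
Qed.

Lemma steps_seq M c1 c2 s (P Q : state -> Prop) :
  steps M c1 s P -> (forall s', P s' -> steps M c2 s' Q) ->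
  steps M (Seq c1 c2) s Q.
Proof.
move=> [s1 [n1 [ex1 le1 Ps]]] /(_ _ Ps) [s2 [n2 [ex2 le2 Qs]]].
by exists s2, (n1 + n2); split=> //=; [apply: ExecSeq ex1 ex2 | apply: leq_add].
Qed.

Lemma steps_while M m e c (P : nat -> state -> Prop) s :
  m <= M -> P 0 s ->
  (forall i s', P i s' -> eval s' e = (i < m) :> nat) ->
  (forall i s', i < m -> P i s' -> steps M c s' (P i.+1)) ->
  steps M (While e c) s (P m).
Proof.
move=> le_mM P0 cond body.
set u := (cost e).+1 + wcost M c.
suff: forall k i s', i + k = m -> P i s' ->
    exists s'' n, [/\ exec (While e c) s' s'' n, n <= k.+1 * u & P m s''].
  move=> /(_ m 0 s erefl P0) [s' [n [ex le_n Pm]]].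
  by exists s', n; split=> //=; apply: leq_trans le_n _; rewrite leq_mul2r ltnS le_mM orbT.
elim=> [|k IH] i s' ikm Pi; have := cond _ _ Pi.
  have -> : i = m by lia.
  rewrite ltnn => /= e0.
  exists s', (cost e).+1; split; [exact: ExecWhileFalse | by rewrite mul1n leq_addr|].
  by have <- : i = m by lia.
have lt_im : i < m by lia.
rewrite lt_im /= => e1.
have [s1 [n1 [ex1 le1 P1]]] := body _ _ lt_im Pi.
have [||s2 [n2 [ex2 le2 P2]]] := IH i.+1 s1 => //; first by lia.
exists s2, ((cost e).+1 + n1 + n2); split=> //.
  by apply: ExecWhileTrue ex1 ex2; rewrite e1.
by rewrite [k.+2 * _]mulSn leq_add // leq_add2l.
Qed.

(** * A language of bounded loops *)

Inductive binop := OAdd | OSub | OLeq.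

(** The binders of [XIter bound init body] receive the value built so far and the
    turn number.  Binding by functions on a type of variables [V] makes
    substitution unnecessary both in the meaning and in the code. *)
Inductive bexpr (V : Type) : Type :=
  | XVar of V
  | XConst of nat
  | XGet of nat & bexpr V
  | XBin of binop & bexpr V & bexpr V
  | XIter of bexpr V & bexpr V & (V -> V -> bexpr V).

Inductive bcmd (V : Type) : Type :=
  | CStore of nat & bexpr V & bexpr V
  | CSeq of bcmd V & bcmd V
  | CFor of bexpr V & (V -> bcmd V).

Definition memory := nat -> nat -> nat.

Definition op_val (o : binop) (m n : nat) : nat :=
  match o with OAdd => m + n | OSub => m - n | OLeq => m <= n end.

Definition op_expr (o : binop) : expr -> expr -> expr :=
  match o with OAdd => Add | OSub => Defs.Sub | OLeq => Leq end.

Definition upd (A : memory) (a i n : nat) : memory :=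
  fun a' i' => if (a' == a) && (i' == i) then n else A a' i'.

(** Loops are cut after [N] turns, so that no program can run for long; programs
    are only applied where their loops are shorter than that. *)
Fixpoint den (N : nat) (A : memory) (e : bexpr nat) : nat :=
  match e with
  | XVar v => v
  | XConst n => n
  | XGet a e1 => A a (den N A e1)
  | XBin o e1 e2 => op_val o (den N A e1) (den N A e2)
  | XIter eb e0 f =>
      iteri (minn N (den N A eb)) (fun i acc => den N A (f acc i)) (den N A e0)
  end.

Fixpoint cden (N : nat) (c : bcmd nat) (A : memory) : memory :=
  match c with
  | CStore a e1 e2 => upd A a (den N A e1) (den N A e2)
  | CSeq c1 c2 => cden N c2 (cden N c1 A)
  | CFor eb f => iteri (minn N (den N A eb)) (fun i => cden N (f i)) A
  end.

(** Truncated subtraction turns [N - (N - m)] into the minimum of [N] and [m]. *)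
Definition loop_clip (d : nat) : cmd :=
  SetReg d (Defs.Sub (Reg 0) (Defs.Sub (Reg 0) (Reg d))).

(** The result goes to register [d] and the registers from [d] on are scratch; the
    variables in scope live below [d], and register 0 holds [N].  A loop keeps its
    number of turns in [d], the value built so far in [d.+1] and the turn counter in
    [d.+2]. *)
Fixpoint compile (d : nat) (e : bexpr nat) : cmd :=
  match e with
  | XVar r => SetReg d (Reg r)
  | XConst n => SetReg d (Const n)
  | XGet a e1 => Seq (compile d e1) (SetReg d (Get a (Reg d)))
  | XBin o e1 e2 =>
      Seq (compile d e1) (Seq (compile d.+1 e2)
        (SetReg d (op_expr o (Reg d) (Reg d.+1))))
  | XIter eb e0 f =>
      Seq (compile d eb) (Seq (loop_clip d) (Seq (compile d.+1 e0)
        (Seq (SetReg d.+2 (Const 0))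
        (Seq (While (Leq (Add (Reg d.+2) (Const 1)) (Reg d))
                (Seq (compile d.+3 (f d.+1 d.+2))
                (Seq (SetReg d.+1 (Reg d.+3))
                     (SetReg d.+2 (Add (Reg d.+2) (Const 1))))))
             (SetReg d (Reg d.+1))))))
  end.

Fixpoint compile_cmd (d : nat) (c : bcmd nat) : cmd :=
  match c with
  | CStore a e1 e2 =>
      Seq (compile d e1) (Seq (compile d.+1 e2) (Store a (Reg d) (Reg d.+1)))
  | CSeq c1 c2 => Seq (compile_cmd d c1) (compile_cmd d c2)
  | CFor eb f =>
      Seq (compile d eb) (Seq (loop_clip d) (Seq (SetReg d.+1 (Const 0))
        (While (Leq (Add (Reg d.+1) (Const 1)) (Reg d))
           (Seq (compile_cmd d.+2 (f d.+1))
                (SetReg d.+1 (Add (Reg d.+1) (Const 1)))))))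
  end.

(** The two expressions are the same one, with registers as variables on the left
    and values on the right; [G] lists the register and the value of each variable
    in scope.  For an actual program this is proved by following its syntax. *)
Inductive wf (G : seq (nat * nat)) : bexpr nat -> bexpr nat -> Prop :=
  | WVar r v : (r, v) \in G -> wf G (XVar r) (XVar v)
  | WConst n : wf G (XConst _ n) (XConst _ n)
  | WGet a e e' : wf G e e' -> wf G (XGet a e) (XGet a e')
  | WBin o e1 e1' e2 e2' :
      wf G e1 e1' -> wf G e2 e2' -> wf G (XBin o e1 e2) (XBin o e1' e2')
  | WIter eb eb' e0 e0' f f' :
      wf G eb eb' -> wf G e0 e0' ->
      (forall r1 v1 r2 v2,
         wf [:: (r1, v1), (r2, v2) & G] (f r1 r2) (f' v1 v2)) ->
      wf G (XIter eb e0 f) (XIter eb' e0' f').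

Inductive cwf (G : seq (nat * nat)) : bcmd nat -> bcmd nat -> Prop :=
  | WStore a e1 e1' e2 e2' :
      wf G e1 e1' -> wf G e2 e2' -> cwf G (CStore a e1 e2) (CStore a e1' e2')
  | WSeq c1 c1' c2 c2' :
      cwf G c1 c1' -> cwf G c2 c2' -> cwf G (CSeq c1 c2) (CSeq c1' c2')
  | WFor eb eb' f f' :
      wf G eb eb' -> (forall r v, cwf ((r, v) :: G) (f r) (f' v)) ->
      cwf G (CFor eb f) (CFor eb' f').

Definition holds (d : nat) (G : seq (nat * nat)) (s : state) : Prop :=
  forall p, p \in G -> p.1 < d /\ regs s p.1 = p.2.

Definition same_below (d : nat) (s s' : state) : Prop :=
  forall r, r < d -> regs s' r = regs s r.

Lemma same_belowW d d' s s' : d' <= d -> same_below d s s' -> same_below d' s s'.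
Proof. by move=> le_d H r lt_r; apply: H; apply: leq_trans le_d. Qed.

Lemma same_below_trans d s1 s2 s3 :
  same_below d s1 s2 -> same_below d s2 s3 -> same_below d s1 s3.
Proof. by move=> H1 H2 r lt_r; rewrite H2 // H1. Qed.

Lemma same_below_set d r s n : d <= r -> same_below d s (set_reg s r n).
Proof. by move=> le_d r' lt_r /=; case: eqP => // ?; lia. Qed.

Lemma holds_below d d' G s s' :
  holds d G s -> same_below d s s' -> d <= d' -> holds d' G s'.
Proof.
move=> H S le_d p /H [lt_p <-]; split; first exact: leq_trans le_d.
exact: S.
Qed.

Lemma holds_cons d G s r : r < d -> holds d G s -> holds d ((r, regs s r) :: G) s.
Proof. by move=> lt_r H p; rewrite inE => /predU1P [-> //|/H]. Qed.

(** Since [M] bounds the number of turns of every loop, [wcost] applies to the code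
    whatever the values that the variables take. *)
Lemma compile_correct G e e' : wf G e e' ->
  forall M d s, 0 < d -> regs s 0 <= M -> holds d G s ->
  steps M (compile d e) s (fun s' =>
    [/\ regs s' d = den (regs s 0) (arrays s) e', same_below d s s'
      & arrays s' = arrays s]).
Proof.
elim=> {G e e'} [G r v Gv|G n|G a e e' _ IH|G o e1 e1' e2 e2' _ IH1 _ IH2
    |G eb eb' e0 e0' f f' _ IHb _ IH0 _ IHf] M d s d_gt0 le_M Hs /=.
- apply: steps_set; split=> //=; last exact: same_below_set.
  by rewrite eqxx; have [] := Hs _ Gv.
- by apply: steps_set; split=> //=; rewrite ?eqxx //; apply: same_below_set.
- apply: steps_seq (IH M d s d_gt0 le_M Hs) _ => s1 [v1 S1 A1].
  apply: steps_set; split=> //=; first by rewrite eqxx v1 A1.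
  exact: same_below_trans S1 (same_below_set _ _ _).
- apply: steps_seq (IH1 M d s d_gt0 le_M Hs) _ => s1 [v1 S1 A1].
  have r0 : regs s1 0 = regs s 0 by apply: S1.
  apply: (steps_seq (IH2 M d.+1 s1 isT _ _)); first by rewrite r0.
    exact: holds_below Hs S1 _.
  move=> s2 [v2 S2 A2]; apply: steps_set; split=> //=; last 2 first.
  + apply: same_below_trans S1 _.
    exact: same_below_trans (same_belowW _ S2) (same_below_set _ _ _).
  + by rewrite A2.
  rewrite eqxx; have := S2 d (leqnn _); rewrite v1 => v1'.
  by case: o => /=; rewrite v1' v2 r0 A1.
- set N := regs s 0; set m := minn N _.
  apply: steps_seq (IHb M d s d_gt0 le_M Hs) _ => s1 [v1 S1 A1].
  have r1 : regs s1 0 = N by apply: S1.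
  apply: (@steps_seq _ _ _ _ (fun s' => [/\ regs s' d = m, same_below d s s'
      & arrays s' = arrays s])).
    apply: steps_set; split=> //=; last first.
      exact: same_below_trans S1 (same_below_set _ _ _).
    by rewrite eqxx r1 v1 /m /N; lia.
  move=> s2 {v1 S1 r1 A1 s1} [v2 S2 A2]; have r2 : regs s2 0 = N by apply: S2.
  apply: (steps_seq (IH0 M d.+1 s2 isT _ _)); first by rewrite r2.
    exact: holds_below Hs S2 _.
  move=> s3 [v3 S3 A3]; have r3 : regs s3 0 = N by rewrite S3.
  pose P i s' := [/\ regs s' d.+1 =
        iteri i (fun i acc => den N (arrays s) (f' acc i)) (den N (arrays s) e0'),
      regs s' d.+2 = i, regs s' d = m, same_below d s s' & arrays s' = arrays s].
  apply: (@steps_seq _ _ _ _ (P 0)).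
    apply: steps_set; split=> //=.
    + by rewrite ifN ?v3 ?r2 ?A2 //; lia.
    + by rewrite eqxx.
    + by rewrite ifN ?S3 //; lia.
    + apply: same_below_trans S2 _.
      apply: same_below_trans (same_belowW _ S3) (same_below_set _ _ _) => //.
      by lia.
    + by rewrite A3.
  move=> s4 {v2 S2 A2 r2 s2 v3 S3 A3 r3 s3} P4.
  apply: (@steps_seq _ _ _ _ (P m)); last first.
    move=> s5 [v5 _ _ S5 A5]; apply: steps_set; split=> //=.
      by rewrite eqxx v5.
    exact: same_below_trans S5 (same_below_set _ _ _).
  apply: steps_while P4 _ _; first by rewrite (leq_trans (geq_minl _ _)).
    by move=> i s' [_ /= -> -> _ _]; rewrite addn1.
  move=> i s' lt_im [va vi vd S A].
  have r0 : regs s' 0 = N by apply: S.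
  apply: (steps_seq (IHf d.+1 (regs s' d.+1) d.+2 (regs s' d.+2) M d.+3 s' isT _ _)).
  + by rewrite r0.
  + apply: holds_cons; first by lia.
    by apply: holds_cons => //; apply: holds_below Hs S _; lia.
  move=> s5 [v5 S5 A5].
  apply: steps_seq (steps_set _ _) _.
    instantiate (1 := fun s' => s' = set_reg s5 d.+1 (regs s5 d.+3)) => //.
  move=> _ ->; apply: steps_set; split=> /=.
  + by rewrite ifN ?eqxx ?v5 ?A ?r0 ?va ?vi //; lia.
  + by rewrite eqxx ifN ?S5 ?vi ?addn1 //; lia.
  + by rewrite !ifN ?S5 ?vd //; lia.
  + apply: same_below_trans S _.
    apply: same_below_trans (same_belowW _ S5) _; first by lia.
    by apply: same_below_trans (same_below_set _ _ _) (same_below_set _ _ _); lia.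
  + by rewrite A5.
Qed.

Lemma compile_cmd_correct G c c' : cwf G c c' ->
  forall M d s, 0 < d -> regs s 0 <= M -> holds d G s ->
  steps M (compile_cmd d c) s (fun s' =>
    same_below d s s' /\ arrays s' = cden (regs s 0) c' (arrays s)).
Proof.
elim=> {G c c'} [G a e1 e1' e2 e2' w1 w2|G c1 c1' c2 c2' _ IH1 _ IH2
    |G eb eb' f f' wb _ IHf] M d s d_gt0 le_M Hs /=.
- apply: steps_seq (compile_correct w1 d_gt0 le_M Hs) _ => s1 [v1 S1 A1].
  have r0 : regs s1 0 = regs s 0 by apply: S1.
  apply: (steps_seq (compile_correct w2 (M := M) (d := d.+1) (s := s1) isT _ _)).
  + by rewrite r0.
  + exact: holds_below Hs S1 _.
  move=> s2 [v2 S2 A2]; apply: steps_store; split=> /=.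
    exact: same_below_trans S1 (same_belowW _ S2).
  by rewrite S2 // v1 v2 A2 A1 r0.
- apply: steps_seq (IH1 M d s d_gt0 le_M Hs) _ => s1 [S1 A1].
  have r0 : regs s1 0 = regs s 0 by apply: S1.
  have [| |] := IH2 M d s1 d_gt0 _ _; first by rewrite r0.
    exact: holds_below Hs S1 _.
  move=> s2 [n [ex2 le_n [S2 A2]]]; exists s2, n; split=> //; split.
    exact: same_below_trans S1 S2.
  by rewrite A2 A1 r0.
- set N := regs s 0; set m := minn N _.
  apply: steps_seq (compile_correct wb d_gt0 le_M Hs) _ => s1 [v1 S1 A1].
  have r1 : regs s1 0 = N by apply: S1.
  apply: (@steps_seq _ _ _ _ (fun s' => [/\ regs s' d = m, same_below d s s'
      & arrays s' = arrays s])).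
    apply: steps_set; split=> //=; last first.
      exact: same_below_trans S1 (same_below_set _ _ _).
    by rewrite eqxx r1 v1 /m /N; lia.
  move=> s2 {v1 S1 r1 A1 s1} [v2 S2 A2].
  pose P i s' := [/\ regs s' d.+1 = i, regs s' d = m, same_below d s s'
      & arrays s' = iteri i (fun i => cden N (f' i)) (arrays s)].
  apply: (@steps_seq _ _ _ _ (P 0)).
    apply: steps_set; split=> //=.
    + by rewrite eqxx.
    + by rewrite ifN //; lia.
    + exact: same_below_trans S2 (same_below_set _ _ _).
  move=> s4 {v2 S2 A2 s2} P4.
  apply: (@steps_weaken _ _ _ (P m)); first by move=> s' [].
  apply: steps_while P4 _ _; first by rewrite (leq_trans (geq_minl _ _)).
    by move=> i s' [/= -> -> _ _]; rewrite addn1.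
  move=> i s' lt_im [vi vd S A].
  have r0 : regs s' 0 = N by apply: S.
  apply: (steps_seq (IHf d.+1 (regs s' d.+1) M d.+2 s' isT _ _)).
  + by rewrite r0.
  + by apply: holds_cons => //; apply: holds_below Hs S _; lia.
  move=> s5 [S5 A5]; apply: steps_set; split=> /=.
  + by rewrite eqxx S5 // vi addn1.
  + by rewrite ifN ?S5 ?vd //; lia.
  + apply: same_below_trans S _.
    by apply: same_below_trans (same_belowW _ S5) (same_below_set _ _ _); lia.
  + by rewrite A5 r0 A vi.
Qed.

(** * Derived expressions *)

Declare Scope bexpr_scope.
Delimit Scope bexpr_scope with X.
Bind Scope bexpr_scope with bexpr.

Notation "# n" := (XConst _ n) (at level 8, format "# n") : bexpr_scope.
Notation "x + y" := (XBin OAdd x y) : bexpr_scope.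
Notation "x - y" := (XBin OSub x y) : bexpr_scope.
Notation "x <= y" := (XBin OLeq x y) : bexpr_scope.
Notation "x < y" := (XBin OLeq (XBin OAdd x (XConst _ 1)) y) : bexpr_scope.

Section Derived.

Variable V : Type.
Implicit Types (x y e : bexpr V) (f : bexpr V -> bexpr V).

(** Truth values are the numbers 0 and 1. *)
Definition xconj x y := (#2 <= x + y)%X.
Definition xdisj x y := (#1 <= x + y)%X.
Definition xeq x y := xconj (x <= y) (y <= x).
Definition xsum x f :=
  XIter x #0 (fun acc i => XVar acc + f (XVar i))%X.
Definition xex x f := (#1 <= xsum x f)%X.
Definition xmul x y := xsum y (fun _ => x).
(** Counts the positive multiples of [y] up to [x]. *)
Definition xdiv x y := xsum x (fun i => xmul y (i + #1) <= x)%X.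
Definition xmod x y := (x - xmul y (xdiv x y))%X.
(** A loop of a single turn, which computes [e] once and names it. *)
Definition xlet e f := XIter #1 e (fun acc _ => f (XVar acc)).

End Derived.


Lemma sum_count (P : pred nat) n : \sum_(i < n) P i = count P (iota 0 n).
Proof.
elim: n => [|n IH]; first by rewrite big_ord0.
rewrite big_ord_recr IH; have -> : iota 0 n.+1 = iota 0 n ++ [:: n].
  by rewrite -addn1 iotaD.
by rewrite count_cat /= addn0.
Qed.

Lemma sum_ltn n k : \sum_(i < n) (i < k) = minn n k.
Proof. by elim: n => [|n IH]; rewrite ?big_ord0 ?big_ord_recr /= ?IH; lia. Qed.

Section DenDerived.

Variables (N : nat) (A : memory).
Implicit Types (x y e : bexpr nat) (f : bexpr nat -> bexpr nat).
Local Notation "⟦ e ⟧" := (den N A e) (at level 0, e at level 99).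

Lemma den_add x y : ⟦ x + y ⟧ = ⟦x⟧ + ⟦y⟧.
Proof. by []. Qed.

Lemma den_sub x y : ⟦ x - y ⟧ = ⟦x⟧ - ⟦y⟧.
Proof. by []. Qed.

Lemma den_leq x y : ⟦ x <= y ⟧ = (⟦x⟧ <= ⟦y⟧).
Proof. by []. Qed.

Lemma den_ltn x y : ⟦ x < y ⟧ = (⟦x⟧ < ⟦y⟧).
Proof. by rewrite den_leq /= addn1. Qed.

Lemma den_get a x : ⟦ XGet a x ⟧ = A a ⟦x⟧.
Proof. by []. Qed.

Lemma den_var v : ⟦ XVar v ⟧ = v.
Proof. by []. Qed.

Lemma den_conj x y (p q : bool) : ⟦x⟧ = p -> ⟦y⟧ = q -> ⟦ xconj x y ⟧ = p && q.
Proof. by rewrite /xconj /= => -> ->; case: p q => [] []. Qed.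

Lemma den_disj x y (p q : bool) : ⟦x⟧ = p -> ⟦y⟧ = q -> ⟦ xdisj x y ⟧ = p || q.
Proof. by rewrite /xdisj /= => -> ->; case: p q => [] []. Qed.

Lemma den_not x (p : bool) : ⟦x⟧ = p -> ⟦ # 1 - x ⟧ = ~~ p.
Proof. by move=> /= ->; case: p. Qed.

Lemma den_eq x y : ⟦ xeq x y ⟧ = (⟦x⟧ == ⟦y⟧).
Proof. by rewrite (den_conj (den_leq x y) (den_leq y x)) eqn_leq. Qed.

Lemma den_iter x e (f : nat -> nat -> bexpr nat) : ⟦x⟧ <= N ->
  ⟦ XIter x e f ⟧ = iteri ⟦x⟧ (fun i acc => ⟦ f acc i ⟧) ⟦e⟧.
Proof. by move=> le_N /=; rewrite (minn_idPr le_N). Qed.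

Lemma den_sum x f : ⟦x⟧ <= N ->
  ⟦ xsum x f ⟧ = \sum_(i < ⟦x⟧) ⟦ f (XVar (val i)) ⟧.
Proof.
move=> le_N /=; rewrite (minn_idPr le_N); elim: ⟦x⟧ => [|n IH] /=.
  by rewrite big_ord0.
by rewrite big_ord_recr /= IH.
Qed.

Lemma den_count x f (P : pred nat) m : ⟦x⟧ = m -> m <= N ->
  (forall i, i < m -> ⟦ f (XVar i) ⟧ = P i) ->
  ⟦ xsum x f ⟧ = count P (iota 0 m).
Proof.
move=> xm le_N fP; rewrite den_sum ?xm // -sum_count.
by apply: eq_bigr => i _; rewrite fP ?ltn_ord.
Qed.

Lemma den_ex x f (P : pred nat) m : ⟦x⟧ = m -> m <= N ->
  (forall i, i < m -> ⟦ f (XVar i) ⟧ = P i) ->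
  ⟦ xex x f ⟧ = has P (iota 0 m).
Proof.
move=> xm le_N fP; rewrite /xex den_leq (den_count xm le_N fP).
by rewrite has_count.
Qed.

Lemma den_mul x y : ⟦y⟧ <= N -> ⟦ xmul x y ⟧ = ⟦x⟧ * ⟦y⟧.
Proof. by move=> le_N; rewrite /xmul den_sum // sum_nat_const card_ord mulnC. Qed.

Lemma den_div x y : ⟦x⟧ <= N -> 0 < ⟦y⟧ -> ⟦ xdiv x y ⟧ = ⟦x⟧ %/ ⟦y⟧.
Proof.
move=> le_N y_gt0; rewrite /xdiv den_sum //.
rewrite (eq_bigr (fun i : 'I_ _ => (i < ⟦x⟧ %/ ⟦y⟧)%N : nat)); last first.
  move=> i _; rewrite den_leq den_mul /= ?addn1 ?leq_divRL 1?mulnC //.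
  exact: leq_trans (ltn_ord i) le_N.
by rewrite sum_ltn; apply/minn_idPr/leq_div.
Qed.

Lemma den_mod x y : ⟦x⟧ <= N -> 0 < ⟦y⟧ -> ⟦ xmod x y ⟧ = ⟦x⟧ %% ⟦y⟧.
Proof.
move=> le_N y_gt0; rewrite /xmod den_sub den_mul den_div //.
  by rewrite modn_def edivn_def /= {1}(divn_eq ⟦x⟧ ⟦y⟧) mulnC addKn.
exact: leq_trans (leq_div _ _) le_N.
Qed.

Lemma den_let e f : 0 < N -> ⟦ xlet e f ⟧ = ⟦ f (XVar ⟦e⟧) ⟧.
Proof. by move=> N_gt0 /=; rewrite (minn_idPr N_gt0). Qed.

End DenDerived.

(** The rule of invariants, for loops that the bound [N] does not cut. *)
Lemma den_for N A e f (P : nat -> memory -> Prop) : den N A e <= N -> P 0 A ->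
  (forall i B, i < den N A e -> P i B -> P i.+1 (cden N (f i) B)) ->
  P (den N A e) (cden N (CFor e f) A).
Proof.
move=> le_N P0 PS /=; rewrite (minn_idPr le_N).
elim: {-2}(den N A e) (leqnn (den N A e)) => //= m IH lt_m.
by apply: PS => //; apply: IH; apply: ltnW.
Qed.

(** * The program *)

(** Array 0 is the input and array 1 the output, whose current length is in cell 0
    of array 5.  Arrays 3 and 4 hold the box: the lower ends, and the distances of
    the upper ends to [b].  Array 2 is the table of reachable states. *)

Section Program.

Variable V : Type.
Variables N b : bexpr V.
Implicit Types x y v w t i a e c q : bexpr V.

Definition p_in x := XGet 0 x.
Definition p_T := p_in #0.
Definition p_nvars := (p_T + p_T + p_T + #4)%X.
Definition p_field (j : nat) t := p_in (xmul t #8 + #j)%X.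
(** Domains have various lengths, so the block of variable [x] is found by jumping
    over the [x] blocks before it. *)
Definition p_pos x :=
  XIter x (xmul p_T #8 + #1)%X (fun pos _ => XVar pos + #1 + p_in (XVar pos))%X.
Definition p_mem x v :=
  xex (p_in (p_pos x)) (fun k => xeq (p_in (p_pos x + #1 + k)) v)%X.

Definition p_lo x := XGet 3 x.
Definition p_up x := XGet 4 x.

Definition p_allowed x w y v :=
  xconj (p_lo y <= v)%X (xconj (v + p_up y < b)%X (xeq y x <= xeq v w)%X).

Definition p_code t i a e c :=
  (xmul (xmul (xmul (xmul t b + i) b + a) b + e) b + c)%X.

Definition p_move x w t X Y i :=
  xconj (p_allowed x w t X) (xconj (p_allowed x w (p_T + t) i)
  (xconj (p_allowed x w (p_T + p_T + t) Y) (xconj (X <= xmul (p_field 6 t) Y)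
  (xconj (p_field 5 t <= X) (xconj (X <= p_field 6 t)
  (xconj (p_field 7 t <= i) (i <= p_field 8 t)))))))%X.

Definition p_pre t X Y i a e c :=
  xconj (xmul (p_field 1 t) X <= a) (xconj (xmul (p_field 2 t) i <= e)
  (xconj (xmul (p_field 3 t) Y <= c) (xconj (X <= p_field 4 t + i)
  (p_field 4 t + i - X < b))))%X.

Definition p_step x w t i a e c :=
  xconj (#0 < t) (xlet (t - #1) (fun t => xex b (fun X => xex #2 (fun Y =>
    xconj (p_move x w t X Y i) (xconj (p_pre t X Y i a e c)
    (#0 < XGet 2 (p_code t (p_field 4 t + i - X)
       (a - xmul (p_field 1 t) X) (e - xmul (p_field 2 t) i)
       (c - xmul (p_field 3 t) Y))))))))%X.

Definition p_cell x w q :=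
  xdisj (xeq q #0)
    (xlet (xdiv q b) (fun q1 => xlet (xdiv q1 b) (fun q2 =>
     xlet (xdiv q2 b) (fun q3 => xlet (xdiv q3 b) (fun t =>
     xlet (xmod q3 b) (fun i => xlet (xmod q2 b) (fun a =>
     xlet (xmod q1 b) (fun e => xlet (xmod q b) (fun c =>
       p_step x w t i a e c))))))))).

Definition p_feasible x w :=
  xex b (fun a => xex b (fun e => xex b (fun c =>
    xconj (#0 < XGet 2 (p_code p_T #0 a e c))
    (xconj (p_allowed x w (p_T + p_T + p_T) a)
    (xconj (p_allowed x w (p_T + p_T + p_T + #1) e)
    (xconj (p_allowed x w (p_T + p_T + p_T + #2) c)
    (p_allowed x w (p_T + p_T + p_T + #3) (a + e + c)))))))%X).

(** The bound of variable [x] kept in array [arr], whose value is [w], moves inwards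
    by one unless [w] is supported. *)
Definition p_prune x w (arr : nat) :=
  CSeq (CFor N (fun q : V => CStore 2 (XVar q) (p_cell x w (XVar q))))
    (CStore arr x
       (XGet arr x + (#1 - xconj (p_mem x w) (p_feasible x w)))%X).

Definition p_sweep :=
  CFor p_nvars (fun y : V =>
    CSeq (p_prune (XVar y) (p_lo (XVar y)) 3)
         (p_prune (XVar y) (b - #1 - p_up (XVar y))%X 4)).

(** The value is written in any case but the length grows only if [c] holds: a
    rejected value is overwritten later or stays beyond the end of the output. *)
Definition p_emit c e :=
  CSeq (CStore 1 (XGet 5 #0) e) (CStore 5 #0 (XGet 5 #0 + c)%X).

Definition p_nonempty := (#1 - xex p_nvars (fun x => b <= p_lo x + p_up x))%X.

Definition p_kept x v :=
  xconj (p_mem x v) (xconj (p_lo x <= v) (v + p_up x < b))%X.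

Definition p_output :=
  CSeq (p_emit #1 p_nonempty)
    (* The factor skips the domains when the box is empty. *)
    (CFor (xmul p_nvars p_nonempty) (fun x : V =>
       CSeq (p_emit #1 (xsum b (p_kept (XVar x))))
         (CFor b (fun v : V => p_emit (p_kept (XVar x) (XVar v)) (XVar v))))).

Definition p_main := CSeq (CFor N (fun _ => p_sweep)) p_output.

End Program.

(** * Meaning of the expressions of the program *)

Definition posn (W : nat -> nat) (x : nat) : nat :=
  iteri x (fun _ pos => pos + 1 + W pos) (W 0 * 8 + 1).

Definition listed (W : nat -> nat) (x v : nat) : bool :=
  has (fun k => W (posn W x + 1 + k) == v) (iota 0 (W (posn W x))).

Section Values.

Variables (N b : nat) (A : memory).
Hypotheses (b_gt8 : 8 < b) (le_bN : b <= N).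

Local Notation W := (A 0).
Local Notation T := (A 0 0).
Local Notation lo := (A 3).
Local Notation up := (A 4).
Local Notation den := (den N A).
Local Notation Nx := (XVar N).
Local Notation bx := (XVar b).

Lemma den_field j t tv : den t = tv -> den (p_field j t) = field W j tv.
Proof.
move=> <-; rewrite /p_field /p_in den_get den_add den_mul //=.
by lia.
Qed.

Lemma den_pos x xv : den x = xv -> xv <= N -> den (p_pos x) = posn W xv.
Proof. by move=> <- le_N; rewrite /p_pos den_iter // den_add den_mul //=; lia. Qed.

Lemma den_mem x v xv vv : den x = xv -> den v = vv -> xv <= N ->
  W (posn W xv) <= N -> den (p_mem x v) = listed W xv vv.
Proof.
move=> xE vE le_x le_N; rewrite /p_mem /listed.
have posE := den_pos xE le_x.
apply: den_ex => // [|k _]; first by rewrite den_get posE.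
by rewrite den_eq den_get !den_add posE vE.
Qed.

Lemma den_allowed x w y v xv wv yv vv :
  den x = xv -> den w = wv -> den y = yv -> den v = vv ->
  den (p_allowed bx x w y v) = allowed b lo up xv wv yv vv.
Proof.
move=> xE wE yE vE; apply: den_conj; first by rewrite den_leq den_get yE vE.
apply: den_conj; first by rewrite den_ltn den_add den_get yE vE.
by rewrite den_leq !den_eq xE wE yE vE.
Qed.

Lemma den_code t i a e c tv iv av ev cv :
  den t = tv -> den i = iv -> den a = av -> den e = ev -> den c = cv ->
  den (p_code bx t i a e c) = code b tv iv av ev cv.
Proof.
by move=> tE iE aE eE cE; rewrite /p_code !(den_add, den_mul) // tE iE aE eE cE.
Qed.

Definition move_of x w :=
  move (field W 5) (field W 6) (field W 7) (field W 8) (allowed b lo up x w)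
    (fun t => allowed b lo up x w (T + t)) (fun t => allowed b lo up x w (T + T + t)).

Lemma den_move x w t X Y i xv wv tv Xv Yv iv :
  den x = xv -> den w = wv -> den t = tv -> den X = Xv -> den Y = Yv ->
  den i = iv -> Yv <= N ->
  den (p_move bx x w t X Y i) = move_of xv wv tv Xv Yv iv.
Proof.
move=> xE wE tE XE YE iE le_Y; rewrite /p_move /move_of /move.
do 3![apply: den_conj; first by apply: den_allowed; rewrite // !den_add tE].
do ![apply: den_conj].
all: by rewrite den_leq ?den_mul ?(den_field _ tE) ?XE ?YE ?iE.
Qed.

Lemma den_pre t X Y i a e c tv Xv Yv iv av ev cv :
  den t = tv -> den X = Xv -> den Y = Yv -> den i = iv ->
  den a = av -> den e = ev -> den c = cv -> Xv <= N -> Yv <= N -> iv <= N ->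
  den (p_pre bx t X Y i a e c)
  = pre b (field W 1) (field W 2) (field W 3) (field W 4) tv Xv Yv iv av ev cv.
Proof.
move=> tE XE YE iE aE eE cE le_X le_Y le_i; rewrite /p_pre /pre.
do ![apply: den_conj].
all: rewrite ?den_ltn ?den_leq ?den_sub ?den_add ?den_mul ?(den_field _ tE);
  by rewrite ?XE ?YE ?iE ?aE ?eE ?cE.
Qed.

Definition step_of x w :=
  reach_step b (field W 1) (field W 2) (field W 3) (field W 4) (field W 5)
    (field W 6) (field W 7) (field W 8) (allowed b lo up x w)
    (fun t => allowed b lo up x w (T + t))
    (fun t => allowed b lo up x w (T + T + t)) (A 2).

Lemma den_step x w t i a e c xv wv tv iv av ev cv :
  den x = xv -> den w = wv -> den t = tv -> den i = iv ->
  den a = av -> den e = ev -> den c = cv -> iv <= N ->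
  den (p_step bx x w t i a e c) = step_of xv wv tv iv av ev cv.
Proof.
move=> xE wE tE iE aE eE cE le_i; rewrite /p_step /step_of /reach_step.
apply: den_conj; first by rewrite den_ltn tE.
rewrite den_let; last by lia.
rewrite den_sub tE subn1; set t1 := XVar tv.-1.
have t1E : den t1 = tv.-1 by [].
apply: den_ex => // X lt_X; apply: den_ex => // [|Y lt_Y]; first by lia.
have XE : den (XVar X) = X by []. have YE : den (XVar Y) = Y by [].
have le_X : X <= N by lia. have le_Y : Y <= N by lia.
apply: den_conj; first exact: den_move.
apply: den_conj; first exact: den_pre.
rewrite den_ltn den_get; congr (_ < A 2 _).
by apply: den_code;
  rewrite ?den_sub ?den_add ?den_mul ?(den_field _ t1E) ?XE ?YE ?iE ?aE ?eE ?cE.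
Qed.

Lemma den_cell x w q xv wv qv :
  den x = xv -> den w = wv -> den q = qv -> qv <= N ->
  den (p_cell bx x w q) = (qv == 0) || at_code b (step_of xv wv) qv.
Proof.
move=> xE wE qE le_q; rewrite /p_cell /at_code.
have N_gt0 : 0 < N by lia.
have b_gt0 : 0 < den bx by rewrite den_var; lia.
have div_le z : z <= N -> z %/ b <= N.
  by move=> le_z; apply: leq_trans (leq_div _ _) le_z.
apply: den_disj; first by rewrite den_eq qE.
have le_q1 := div_le _ le_q; have le_q2 := div_le _ le_q1.
have le_q3 := div_le _ le_q2.
rewrite den_let // den_div ?qE // den_let // den_div // den_let // den_div //.
rewrite den_let // den_div // !den_let // !den_mod ?qE //.
apply: den_step => //.
apply: leq_trans le_bN; apply/ltnW; rewrite ltn_mod; lia.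
Qed.

Definition tabulated x w :=
  forall q, q < N -> A 2 q = at_code b (box_reach T b W lo up x w) q.

Hypothesis NE : b ^ 5 = N.

Lemma code_ltN t i a e c :
  t < b -> i < b -> a < b -> e < b -> c < b -> code b t i a e c < N.
Proof.
move=> lt_t lt_i lt_a lt_e lt_c; rewrite -NE /code.
have grow x y k : x < b ^ k -> y < b -> x * b + y < b ^ k.+1.
  move=> lt_x lt_y; apply: (@leq_trans (x.+1 * b)).
    by rewrite mulSn; lia.
  by rewrite expnSr leq_mul2r lt_x orbT.
by do 4!(apply: (grow) => //); rewrite expn1.
Qed.

Lemma den_feasible x w xv wv :
  den x = xv -> den w = wv -> T < b -> tabulated xv wv ->
  den (p_feasible bx x w) = feasible T b W lo up xv wv.
Proof.
move=> xE wE lt_T tab; rewrite /p_feasible /feasible.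
apply: den_ex => // a lt_a; apply: den_ex => // e lt_e; apply: den_ex => // c lt_c.
apply: den_conj.
  rewrite den_ltn den_get (den_code (tv := T) (iv := 0) (av := a) (ev := e) (cv := c)) //.
  by rewrite tab ?code_ltN ?at_codeE ?lt0b //; lia.
do 3![apply: den_conj; first exact: den_allowed].
exact: den_allowed.
Qed.

End Values.

(** * Convergence of the pruning rounds *)

Section Pruning.

Variables (N b : nat).
Hypotheses (b_gt8 : 8 < b) (le_bN : b <= N) (NE : b ^ 5 = N).

Definition is_supported (A : memory) (x w : nat) : bool :=
  listed (A 0) x w && feasible (A 0 0) b (A 0) (A 3) (A 4) x w.

(** The expression [w] may read the box, which stays the same while the table is
    being filled, but not the table. *)
Lemma fill_table A x w wv :
  (forall B, B 3 = A 3 -> B 4 = A 4 -> den N B w = wv) ->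
  let A1 := cden N (CFor (XVar N) (fun q =>
              CStore 2 (XVar q) (p_cell (XVar b) (XVar x) w (XVar q)))) A in
  [/\ A1 0 = A 0, A1 3 = A 3, A1 4 = A 4, A1 5 = A 5
    & tabulated N b A1 x wv].
Proof.
move=> wE.
pose P q B := [/\ B 0 = A 0, B 3 = A 3, B 4 = A 4, B 5 = A 5 &
  forall q', q' < q ->
    B 2 q' = at_code b (box_reach (A 0 0) b (A 0) (A 3) (A 4) x wv) q'].
move=> A1; have : P N A1.
  apply: (@den_for N A (XVar N)) => // q B lt_q [B0 B3 B4 B5 Bq].
  have cellE : den N B (p_cell (XVar b) (XVar x) w (XVar q))
      = at_code b (box_reach (A 0 0) b (A 0) (A 3) (A 4) x wv) q.
    rewrite (den_cell b_gt8 le_bN (xv := x) (wv := wv) (qv := q)) ?wE //.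
      by rewrite /step_of B0 B3 B4; rewrite reach_stepE //; lia.
    exact: ltnW.
  split=> // q'; rewrite ltnS leq_eqVlt => /predU1P [->|lt_q'].
    by rewrite -cellE [LHS]/= /upd !eqxx.
  by rewrite [LHS]/= /upd eqxx /= ifN ?Bq // neq_ltn lt_q'.
by case=> E0 E3 E4 E5 tab; split=> // q lt_q; rewrite tab // E0 E3 E4.
Qed.

Lemma prune_spec A x w wv arr : arr \in [:: 3; 4] ->
  (forall B, B 3 = A 3 -> B 4 = A 4 -> den N B w = wv) ->
  x <= N -> A 0 (posn (A 0) x) <= N -> A 0 0 < b ->
  let A' := cden N (p_prune (XVar N) (XVar b) (XVar x) w arr) A in
  [/\ A' 0 = A 0, A' 5 = A 5 & forall a y, a \in [:: 3; 4] ->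
      A' a y = A a y + [&& a == arr, y == x & ~~ is_supported A x wv]].
Proof.
move=> arrP wE le_x le_pos lt_T.
have [E0 E3 E4 E5 tab] := fill_table x wE.
set A1 := cden N _ A in E0 E3 E4 E5 tab; have wE1 := wE _ E3 E4; move=> A'.
have supE : den N A1 (xconj (p_mem (XVar x) w) (p_feasible (XVar b) (XVar x) w))
    = is_supported A x wv.
  rewrite /is_supported -E0 -E3 -E4; apply: den_conj.
    by apply: (den_mem b_gt8 le_bN); rewrite // E0.
  by apply: den_feasible; rewrite // E0.
have -> : A' = upd A1 arr x (A1 arr x + ~~ is_supported A x wv).
  by rewrite -(den_not supE).
have A1E a : a \in [:: 3; 4] -> A1 a = A a.
  by rewrite !inE => /orP [] /eqP ->.
split.
- by move: arrP; rewrite !inE => /orP [] /eqP ->.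
- by move: arrP; rewrite !inE => /orP [] /eqP ->.
move=> a y aP; rewrite /upd !A1E //.
by case: eqP => [->|] /=; [case: eqP => [->|] //=|]; rewrite addn0.
Qed.

End Pruning.

Section Narrow.

Variables (T : nat) (data : lot_data T) (D : domains (var T)).
Variables (N b : nat) (W : nat -> nat).
Hypotheses (b_gt8 : 8 < b) (le_bN : b <= N) (NE : b ^ 5 = N).
Hypotheses (lt_Tb : T < b) (le_nb : nvars T <= b).
Hypothesis W_T : W 0 = T.
Hypothesis W_field : forall t : 'I_T,
  [/\ field W 1 t = unit_cost data t, field W 2 t = holding_cost data t,
      field W 3 t = setup_cost data t & field W 4 t = demand data t] /\
  [/\ field W 5 t = prod_min data t, field W 6 t = prod_max data t,
      field W 7 t = stock_min data t & field W 8 t = stock_max data t].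
Hypothesis W_dom : forall x : var T,
  W (posn W (vidx x)) <= N /\ forall v, listed W (vidx x) v = (v \in D x).

Local Notation sup A := (supported data D b (A 3) (A 4)).
Local Notation stab A := (stable data D b (A 3) (A 4)).

Lemma is_supportedP A x w : A 0 = W ->
  reflect (sup A x w) (is_supported b A (vidx x) w).
Proof.
move=> A0; rewrite /is_supported A0 W_T; have [_ ->] := W_dom x.
have b_gt0 : 0 < b by lia.
have feas := feasibleP (A 3) (A 4) b_gt0 W_field x w.
by apply: (iffP andP) => [[Dw /feas]|[Dw /feas]].
Qed.

Definition total (A : memory) : nat := \sum_(x < nvars T) (A 3 x + A 4 x).

Definition same_bounds (A B : memory) : Prop :=
  forall x, x < nvars T -> A 3 x = B 3 x /\ A 4 x = B 4 x.

Definition valid (A : memory) : Prop :=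
  [/\ A 0 = W, A 5 0 = 0 & encloses data D b (A 3) (A 4)].

(** A step from [A] to [B] whose test [ok] either succeeds and changes nothing, or
    fails and narrows the box. *)
Definition progress (ok : Prop) (A B : memory) : Prop :=
  [/\ valid B, total A <= total B
    & (ok /\ same_bounds A B) \/ (~ ok /\ total A < total B)].

Lemma total_bump A B x bump arr : x < nvars T -> arr \in [:: 3; 4] ->
  (forall a y, a \in [:: 3; 4] ->
     B a y = A a y + [&& a == arr, y == x & bump]) ->
  total B = total A + bump.
Proof.
move=> lt_x arrP BE; rewrite /total (bigD1 (Ordinal lt_x)) //=.
rewrite [in RHS](bigD1 (Ordinal lt_x)) //= !BE // !eqxx.
rewrite (eq_bigr (fun y : 'I_(nvars T) => A 3 y + A 4 y)); last first.
  move=> y ne_y; rewrite !BE //.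
  have /negbTE -> : y != x :> nat by [].
  by rewrite !andbF !addn0.
move: arrP; rewrite !inE => /orP [] /eqP ->; rewrite /= addn0; lia.
Qed.

Lemma prune_progress A (x : var T) w wv arr : valid A -> arr \in [:: 3; 4] ->
  (forall B, B 3 = A 3 -> B 4 = A 4 -> den N B w = wv) ->
  (~ sup A x wv -> forall B, (forall a y, a \in [:: 3; 4] ->
     B a y = A a y + ((a == arr) && (y == vidx x))) ->
     encloses data D b (B 3) (B 4)) ->
  progress (sup A x wv) A
    (cden N (p_prune (XVar N) (XVar b) (XVar (vidx x)) w arr) A).
Proof.
case=> A0 A5 enc arrP wE bump_enc; have [pos_le _] := W_dom x.
have lt_x := vidx_lt x.
have le_x : vidx x <= N by lia.
have le_pos : A 0 (posn (A 0) (vidx x)) <= N by rewrite A0.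
have lt_T : A 0 0 < b by rewrite A0 W_T.
have [B0 B5 BE] := prune_spec b_gt8 le_bN NE arrP wE le_x le_pos lt_T.
have := total_bump lt_x arrP BE; move: B0 B5 BE; set B := cden _ _ _.
case: is_supportedP => // [supx|nsup] B0 B5 BE /= totB.
  have same a y : a \in [:: 3; 4] -> A a y = B a y.
    by move=> /BE ->; rewrite !andbF addn0.
  split; last by left; split=> // y _; rewrite !same.
    split; rewrite ?B0 ?B5 // => E sub_E bcE y.
    by have := enc E sub_E bcE y; rewrite !same.
  by rewrite totB addn0.
split; last by right; rewrite totB addn1.
  split; rewrite ?B0 ?B5 //; apply: bump_enc => // a y /BE ->.
  by rewrite andbT.
by rewrite totB leq_addr.
Qed.

Lemma prune_lo_progress A (x : var T) : valid A ->
  progress (sup A x (A 3 (vidx x))) A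
    (cden N (p_prune (XVar N) (XVar b) (XVar (vidx x)) (p_lo (XVar (vidx x))) 3) A).
Proof.
move=> vA; apply: prune_progress => // [B B3 _|nsup B BE].
  by rewrite den_get B3.
have [_ _ enc] := vA; move=> E sub_E bcE y; rewrite !BE //= addn0.
have [lo_y up_y] := enc E sub_E bcE y; split=> //.
case: eqP => [/vidx_inj ->|_]; last by rewrite addn0.
by rewrite addn1; apply: encloses_low nsup.
Qed.

Lemma prune_up_progress A (x : var T) : valid A ->
  progress (sup A x (b.-1 - A 4 (vidx x))) A
    (cden N (p_prune (XVar N) (XVar b) (XVar (vidx x))
               (XVar b - #1 - p_up (XVar (vidx x)))%X 4) A).
Proof.
move=> vA; apply: prune_progress => // [B _ B4|nsup B BE].
  by rewrite !den_sub den_get B4 subn1.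
have [_ _ enc] := vA; move=> E sub_E bcE y; rewrite !BE //= addn0.
have [lo_y up_y] := enc E sub_E bcE y; split=> //.
case: eqP => [/vidx_inj ->|_]; last by rewrite addn0.
by rewrite addn1; apply: encloses_high nsup.
Qed.

Lemma sup_same A B x w : same_bounds A B -> sup A x w -> sup B x w.
Proof. exact: supported_ext. Qed.

Lemma same_bounds_sym A B : same_bounds A B -> same_bounds B A.
Proof. by move=> eqAB x /eqAB []. Qed.

Lemma same_bounds_trans A B C :
  same_bounds A B -> same_bounds B C -> same_bounds A C.
Proof.
by move=> AB BC x lt_x; have [-> ->] := AB x lt_x; apply: BC.
Qed.

(** When the first test succeeds the box is the same as before, so the second test
    may be restated about the initial box. *)
Lemma progress_trans (p q r : Prop) A B C :
  (same_bounds A B -> (q <-> r)) ->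
  progress p A B -> progress q B C -> progress (p /\ r) A C.
Proof.
move=> qr [_ leAB pAB] [vC leBC qBC]; split=> //; first exact: leq_trans leAB leBC.
case: pAB => [[pp sAB]|[np ltAB]]; last first.
  by right; split; [case|apply: leq_trans ltAB leBC].
case: qBC => [[qq sBC]|[nq ltBC]].
  left; split; first by split=> //; apply/(qr sAB).
  exact: same_bounds_trans sAB sBC.
right; split; first by case=> _ /(qr sAB).
exact: leq_ltn_trans leAB ltBC.
Qed.

Definition fixed A x := sup A x (A 3 (vidx x)) /\ sup A x (b.-1 - A 4 (vidx x)).

Lemma fixed_same A B x : same_bounds A B -> fixed A x -> fixed B x.
Proof.
move=> sAB; have [E3 E4] := sAB _ (vidx_lt x); rewrite /fixed E3 E4.
by case=> lo_x up_x; split; apply: sup_same sAB _.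
Qed.

Lemma sweep_progress A : valid A ->
  progress (stab A) A (cden N (p_sweep (XVar N) (XVar b)) A).
Proof.
move=> vA; have [A0 _ _] := vA.
pose P x B := progress (forall y : var T, vidx y < x -> fixed A y) A B.
have nE : den N A (p_nvars nat) = nvars T.
  by rewrite /p_nvars !den_add /= A0 W_T.
suff: P (nvars T) (cden N (p_sweep (XVar N) (XVar b)) A).
  case=> vB leAB H; split=> //.
  have eq_stab : stab A <-> forall y, vidx y < nvars T -> fixed A y.
    by split=> [st y _|H' y]; [apply: st | apply: H'; apply: vidx_lt].
  by case: H => [[/eq_stab]|[n]]; [left|right; split=> // /eq_stab].
rewrite -{1}nE; apply: den_for; first by rewrite nE; lia.
  by split=> //; left; split=> // x.
rewrite nE => i B lt_i PB.
have vB : valid B by case: PB.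
pose x := nth_var T i; have xi : vidx x = i by apply: nth_varK.
have prog_lo := prune_lo_progress x vB.
rewrite xi in prog_lo; move: prog_lo; set C := cden _ _ B => prog_lo.
have vC : valid C by case: prog_lo.
have := prune_up_progress x vC; rewrite xi.
change (cden N _ B) with (cden N (p_prune (XVar N) (XVar b) (XVar i)
   (XVar b - #1 - p_up (XVar i))%X 4) C).
move=> prog_up.
have prog_x := progress_trans _ prog_lo prog_up.
have : progress (fixed B x) B
 (cden N (p_prune (XVar N) (XVar b) (XVar i)
   (XVar b - #1 - p_up (XVar i))%X 4) C).
  rewrite /fixed xi; apply: prog_x => sBC.
  have [_ <-] := sBC i lt_i.
  by split; apply: sup_same => //; apply: same_bounds_sym.
move=> prog; have [vF leF HF] := progress_trans (r := fixed A x)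
  (fun sAB => conj (@fixed_same _ _ x (same_bounds_sym sAB)) (@fixed_same _ _ x sAB))
  PB prog.
have eq_P : (forall y, vidx y < i.+1 -> fixed A y)
    <-> (forall y, vidx y < i -> fixed A y) /\ fixed A x.
  split=> [H|[H Hx] y].
    by split=> [y lt_y|]; apply: H; rewrite ?xi // ltnW.
  rewrite ltnS leq_eqVlt => /predU1P [yi|/H //].
  by have -> : y = x by apply: vidx_inj; rewrite xi.
split=> //; case: HF => [[/eq_P]|[n lt]]; first by left.
by right; split=> // /eq_P.
Qed.

(** Each round is stable or increases [total], so after [N] rounds either the box is
    stable or [total] is at least [N].  In a box that is not empty, [total] is at
    most [nvars T * b.-1], which is less than [N]. *)
Lemma rounds_result A : valid A ->
  let B := cden N (CFor (XVar N) (fun _ => p_sweep (XVar N) (XVar b))) A in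
  valid B /\ (stab B \/ exists x : var T, b <= B 3 (vidx x) + B 4 (vidx x)).
Proof.
move=> vA B; pose P r B := valid B /\ (stab B \/ r <= total B).
have : P N B.
  apply: (@den_for N A (XVar N)) => //.
    by split=> //; right.
  move=> i C lt_i [vC HC].
  have [vF leF HF] := sweep_progress vC; split=> //.
  case: HF => [[st sCF]|[nst ltCF]].
    by left=> x; apply: (fixed_same sCF); apply: st.
  by case: HC => // leC; right; apply: leq_ltn_trans leC ltCF.
case=> vB [st|leB]; split=> //; [by left | right].
have [/existsP [x le_x]|] := boolP [exists x : 'I_(nvars T), b <= B 3 x + B 4 x].
  by exists (nth_var T x); rewrite nth_varK.
rewrite negb_exists => /forallP small.
suff: total B < N by lia.
have: total B <= \sum_(x < nvars T) b.-1.
  by apply: leq_sum => x _; have := small x; lia.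
rewrite sum_nat_const card_ord => leT; apply: (leq_ltn_trans leT).
apply: (@leq_ltn_trans (b * b.-1)); first by rewrite leq_mul2r le_nb orbT.
apply: (@leq_trans (b ^ 2)); first by rewrite expnS expn1 ltn_pmul2l; lia.
by rewrite -NE leq_pexp2l //; lia.
Qed.

End Narrow.

(** * The output word *)

Definition written (A : memory) : seq nat := mkseq (A 1) (A 5 0).

Definition keeps (A B : memory) : Prop := [/\ B 0 = A 0, B 3 = A 3 & B 4 = A 4].

Lemma keeps_trans A B C : keeps A B -> keeps B C -> keeps A C.
Proof. by move=> [B0 B3 B4] [C0 C3 C4]; split; rewrite ?C0 ?C3 ?C4. Qed.

Lemma flatten_nseq_filter (p : pred nat) s :
  flatten [seq nseq (p v) v | v <- s] = filter p s.
Proof. by elim: s => //= v s ->; case: (p v). Qed.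

Lemma emit_spec N A c e (p : bool) n :
  (forall B, keeps A B -> den N B c = p) -> den N A e = n ->
  let B := cden N (p_emit c e) A in
  keeps A B /\ written B = written A ++ nseq p n.
Proof.
move=> cE eE; set A1 := cden N (CStore 1 (XGet 5 #0) e)%X A => B.
have -> : B = upd A1 5 0 (A 5 0 + p) by rewrite -(cE A1).
split=> //; rewrite /written.
have -> : upd A1 5 0 (A 5 0 + p) 5 0 = A 5 0 + p by [].
have A1E i : upd A1 5 0 (A 5 0 + p) 1 i = if i == A 5 0 then n else A 1 i.
  by rewrite -eE.
have same : mkseq (upd A1 5 0 (A 5 0 + p) 1) (A 5 0) = mkseq (A 1) (A 5 0).
  apply/eq_in_map => i; rewrite mem_iota add0n => lt_i.
  by rewrite A1E ltn_eqF.
move: (upd _ _ _ _ 1) A1E same => F FE same.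
case: {cE} p; last by rewrite addn0 cats0.
by rewrite addn1 mkseqS same FE eqxx cats1.
Qed.

(** A loop whose turns each append a word appends the concatenation of them. *)
Lemma append_loop N A e f (g : nat -> seq nat) :
  den N A e <= N ->
  (forall i B, i < den N A e -> keeps A B ->
     keeps B (cden N (f i) B) /\ written (cden N (f i) B) = written B ++ g i) ->
  let B := cden N (CFor e f) A in
  keeps A B /\
  written B = written A ++ flatten [seq g i | i <- iota 0 (den N A e)].
Proof.
move=> le_N step B.
pose P i C := keeps A C /\
  written C = written A ++ flatten [seq g i | i <- iota 0 i].
apply: (@den_for N A e f P) => //; first by rewrite /P /= cats0.
move=> i C lt_i [kC wC]; have [kF wF] := step i C lt_i kC.
split; first exact: keeps_trans kC kF.
by rewrite wF wC -addn1 iotaD map_cat flatten_cat /= cats0 catA.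
Qed.

Section Output.

Variables (T : nat) (D : domains (var T)).
Variables (N b : nat) (W : nat -> nat).
Hypotheses (b_gt8 : 8 < b) (le_bN : b <= N).
Hypotheses (le_nb : nvars T <= b).
Hypothesis D_lt : forall x v, v \in D x -> v < b.
Hypothesis W_T : W 0 = T.
Hypothesis W_dom : forall x : var T,
  W (posn W (vidx x)) <= N /\ forall v, listed W (vidx x) v = (v \in D x).

Definition kept (A : memory) (x v : nat) : bool :=
  [&& listed W x v, A 3 x <= v & v + A 4 x < b].

Definition kept_seq (A : memory) (x : nat) : seq nat := filter (kept A x) (iota 0 b).

Lemma den_kept A B x v xv vv : A 0 = W -> keeps A B -> xv < nvars T ->
  den N B x = xv -> den N B v = vv ->
  den N B (p_kept (XVar b) x v) = kept A xv vv.
Proof.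
move=> A0 [B0 B3 B4] lt_x xE vE.
have [le_N _] := W_dom (nth_var T xv); rewrite nth_varK // in le_N.
rewrite /kept -B3 -B4 -A0 -B0; apply: den_conj.
  by apply: (den_mem b_gt8 le_bN) => //; [lia | rewrite B0 A0].
apply: den_conj; first by rewrite den_leq den_get xE vE.
by rewrite den_ltn den_add den_get xE vE.
Qed.

Lemma den_nonempty A B : A 0 = W -> keeps A B ->
  den N B (p_nonempty (XVar b))
  = ~~ has (fun x => b <= A 3 x + A 4 x) (iota 0 (nvars T)).
Proof.
move=> A0 [B0 B3 B4]; apply: den_not; apply: den_ex.
- by rewrite /p_nvars !den_add /= B0 A0 W_T.
- by lia.
by move=> i _; rewrite den_leq !(den_add, den_get) B3 B4.
Qed.

Lemma output_spec A : A 0 = W -> A 5 0 = 0 ->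
  let ok := ~~ has (fun x => b <= A 3 x + A 4 x) (iota 0 (nvars T)) in
  written (cden N (p_output (XVar b)) A) =
    (ok : nat) :: flatten [seq size (kept_seq A x) :: kept_seq A x
                          | x <- iota 0 (nvars T * ok)].
Proof.
move=> A0 A5 ok; rewrite /p_output.
have okE := den_nonempty A0.
have [] := @emit_spec N A (XConst _ 1) (p_nonempty (XVar b)) true ok.
- by [].
- exact: okE.
set A1 := cden _ _ A => k1 w1.
have nE : den N A1 (xmul (p_nvars nat) (p_nonempty (XVar b))) = nvars T * ok.
  have [B0 _ _] := k1; rewrite den_mul okE //; last by case: (ok); lia.
  by rewrite /p_nvars !den_add /= B0 A0 W_T.
have [] := @append_loop N A1 (xmul (p_nvars nat) (p_nonempty (XVar b)))
  (fun x => CSeq (p_emit (XConst _ 1) (xsum (XVar b) (p_kept (XVar b) (XVar x))))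
         (CFor (XVar b) (fun v => p_emit (p_kept (XVar b) (XVar x) (XVar v)) (XVar v))))
  (fun x => size (kept_seq A x) :: kept_seq A x).
- by rewrite nE; case: (ok); lia.
- rewrite nE => x B lt_x kB; have {}lt_x : x < nvars T by move: lt_x; case: (ok); lia.
  have kAB := keeps_trans k1 kB.
  have [] := @emit_spec N B (XConst _ 1) (xsum (XVar b) (p_kept (XVar b) (XVar x)))
     true (size (kept_seq A x)).
  + by [].
  + rewrite size_filter; apply: den_count => // v lt_v.
    exact: den_kept.
  set B1 := cden _ _ B => k2 w2.
  have [] := @append_loop N B1 (XVar b)
    (fun v => p_emit (p_kept (XVar b) (XVar x) (XVar v)) (XVar v))
    (fun v => nseq (kept A x v) v).
  + by [].
  + move=> v C lt_v kC; apply: emit_spec => // F kF.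
    apply: den_kept => //.
    exact: keeps_trans (keeps_trans kAB k2) (keeps_trans kC kF).
  move=> k3 w3; split; first exact: keeps_trans k2 k3.
  by rewrite [LHS]w3 w2 flatten_nseq_filter -catA.
move=> _ w; rewrite [LHS]w w1 nE.
by rewrite /written A5.
Qed.

Lemma all_vars_iota : all_vars T = [seq nth_var T x | x <- iota 0 (nvars T)].
Proof. by rewrite -size_all_vars; symmetry; apply: mkseq_nth. Qed.

Lemma kept_elements A (x : var T) : A 0 = W ->
  elements (trim D b (A 3) (A 4) x) = kept_seq A (vidx x).
Proof.
move=> A0; apply: elements_eq.
  by apply: sorted_filter; [apply: ltn_trans | apply: iota_ltn_sorted].
move=> v; rewrite mem_filter mem_iota !inE /kept; have [_ ->] := W_dom x.
rewrite /= add0n; case Dv: (v \in D x) => //=.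
by rewrite (D_lt Dv) andbT.
Qed.

Lemma output_some A : A 0 = W -> A 5 0 = 0 ->
  (forall x : var T, A 3 (vidx x) + A 4 (vidx x) < b) ->
  written (cden N (p_output (XVar b)) A)
  = encode_result (Some (trim D b (A 3) (A 4))).
Proof.
move=> A0 A5 ne; rewrite output_spec // /encode_result.
have -> : has (fun x => b <= A 3 x + A 4 x) (iota 0 (nvars T)) = false.
  apply/hasPn => x; rewrite mem_iota add0n => lt_x.
  by rewrite -ltnNge -(nth_varK lt_x).
rewrite muln1; congr (_ :: _); rewrite /encode_domains all_vars_iota -map_comp.
congr flatten; apply/eq_in_map => x; rewrite mem_iota add0n => lt_x /=.
by rewrite kept_elements // nth_varK.
Qed.

Lemma output_none A : A 0 = W -> A 5 0 = 0 ->
  (exists x : var T, b <= A 3 (vidx x) + A 4 (vidx x)) ->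
  written (cden N (p_output (XVar b)) A) = encode_result (None : option (domains (var T))).
Proof.
move=> A0 A5 [x empty]; rewrite output_spec //.
have -> : has (fun x => b <= A 3 x + A 4 x) (iota 0 (nvars T)).
  by apply/hasP; exists (vidx x); rewrite // mem_iota vidx_lt.
by rewrite muln0.
Qed.

End Output.

(** * The whole algorithm *)

Ltac wf_program :=
  repeat match goal with
    | |- is_true _ => first [exact: mem_head | rewrite in_cons; apply/orP; right]
    | |- forall _, _ => intro
    | |- _ => constructor
    end.

Lemma p_main_wf N' N b' b :
  cwf [:: (N', N); (b', b)] (p_main (XVar N') (XVar b')) (p_main (XVar N) (XVar b)).
Proof. wf_program. Qed.

Definition p_base {V} (len : bexpr V) : bexpr V :=
  xsum len (fun i => #1 + p_in i)%X.

Definition p_pow5 {V} (b : bexpr V) : bexpr V :=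
  xmul (xmul (xmul (xmul b b) b) b) b.

(** Register 0 limits the loops: first to the length of the input, which is enough to
    compute [b]; then to [b], which is enough to compute [b ^ 5]; then to [b ^ 5]. *)
Definition algorithm : cmd :=
  Seq (compile 2 (p_base (XVar 0))) (Seq (SetReg 0 (Reg 2))
  (Seq (compile 3 (p_pow5 (XVar 0))) (Seq (SetReg 0 (Reg 3))
  (Seq (compile_cmd 3 (p_main (XVar 0) (XVar 2)))
       (SetReg 1 (Get 5 (Const 0))))))).

(** The base [b] of the algorithm. *)
Definition weight (w : seq nat) : nat := \sum_(n <- w) n.+1.

Lemma den_base A n :
  den n A (p_base (XVar n)) = \sum_(i < n) (A 0 i).+1.
Proof. by rewrite /p_base den_sum //; apply: eq_bigr => i _; rewrite den_add. Qed.

Lemma den_pow5 A b : den b A (p_pow5 (XVar b)) = b ^ 5.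
Proof. by rewrite /p_pow5 !den_mul // den_var !expnS expn0; lia. Qed.

Lemma algorithm_steps M w :
  let A := arrays (input_state w) in
  let b := weight w in let N := b ^ 5 in
  size w <= M -> b <= M -> N <= M ->
  steps M algorithm (input_state w)
    (fun s => output_word s = written (cden N (p_main (XVar N) (XVar b)) A)).
Proof.
move=> A b N; have [Eb EN] : b = weight w /\ N = b ^ 5 by [].
clearbody b N => le_w le_b le_N.
have bE : den (size w) A (p_base (XVar (size w))) = b.
  rewrite den_base Eb /weight (big_nth 0) big_mkord.
  by apply: eq_bigr => i _.
have wf1 : wf [:: (0, size w)] (p_base (XVar 0)) (p_base (XVar (size w))).
  by wf_program.
have wf2 : wf [:: (0, b)] (p_pow5 (XVar 0)) (p_pow5 (XVar b)) by wf_program.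
apply: (steps_seq (compile_correct wf1 (M := M) (d := 2) _ _ _)) => //.
  by move=> p; rewrite inE => /eqP ->.
move=> s1 [r1 S1 A1]; have {}r1 : regs s1 2 = b by rewrite r1; exact: bE.
apply: (@steps_seq _ _ _ _ (fun s => [/\ regs s 0 = b, regs s 2 = b & arrays s = A])).
  by apply: steps_set.
move=> s2 [r02 r22 A2].
apply: (steps_seq (compile_correct wf2 (M := M) (d := 3) _ _ _)) => //.
- by rewrite r02.
- by move=> p; rewrite inE => /eqP ->.
have powE : den b (arrays s2) (p_pow5 (XVar b)) = N by rewrite den_pow5 EN.
rewrite r02 => s3 [r3 S3 A3]; rewrite {}powE in r3.
apply: (@steps_seq _ _ _ _ (fun s => [/\ regs s 0 = N, regs s 2 = b & arrays s = A])).
  by apply: steps_set; split=> //=; rewrite ?S3 ?A3.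
move=> s4 [r04 r24 A4].
apply: (steps_seq (compile_cmd_correct (p_main_wf 0 N 2 b) (M := M) (d := 3) _ _ _)) => //.
- by rewrite r04.
- by move=> p; rewrite !inE => /orP [] /eqP ->.
rewrite r04 A4 => s5 [_ A5]; apply: steps_set.
by rewrite -A5.
Qed.

(** * The input word *)

Lemma weight_cons n w : weight (n :: w) = n.+1 + weight w.
Proof. by rewrite /weight big_cons. Qed.

Lemma size_weight w : size w <= weight w.
Proof. by elim: w => //= n w IH; rewrite weight_cons; lia. Qed.

Lemma weight_gt w n : n \in w -> n < weight w.
Proof.
elim: w => //= m w IH; rewrite weight_cons inE => /predU1P [->|/IH]; lia.
Qed.

Lemma weight_le w m : (forall n, n \in w -> n <= m) -> weight w <= size w * m.+1.
Proof.
elim: w => [|n w IH] H; first by rewrite /weight big_nil.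
rewrite weight_cons mulSn leq_add // ?ltnS; first by apply: H; rewrite mem_head.
by apply: IH => k wk; apply: H; rewrite inE wk orbT.
Qed.

Lemma nth_block (ss : seq (seq nat)) k j r :
  k < size ss -> j < size (nth [::] ss k) ->
  nth 0 (flatten ss ++ r) (size (flatten (take k ss)) + j)
  = nth 0 (nth [::] ss k) j.
Proof.
move=> lt_k lt_j; rewrite -{1}(cat_take_drop k ss) (drop_nth [::] lt_k).
rewrite flatten_cat /= -!catA nth_cat ltnNge leq_addr /= addKn nth_cat lt_j.
by [].
Qed.

Lemma size_flatten_const (ss : seq (seq nat)) m :
  (forall s, s \in ss -> size s = m) -> size (flatten ss) = size ss * m.
Proof.
elim: ss => //= s ss IH H; rewrite size_cat mulSn H ?mem_head // IH // => u ssu.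
by apply: H; rewrite inE ssu orbT.
Qed.

Lemma map_mem_all_vars T (U : eqType) (f : var T -> U) x :
  f x \in [seq f y | y <- all_vars T].
Proof.
have lt_x : vidx x < size (all_vars T) by rewrite size_all_vars vidx_lt.
rewrite -{1}(vidxK x) /nth_var -(nth_map VC (f VC)) //.
by rewrite mem_nth // size_map.
Qed.

Lemma mem_map_inv (I : Type) (U : eqType) (f : I -> U) s u :
  u \in [seq f x | x <- s] -> exists x, u = f x.
Proof. by elim: s => //= x s IH; rewrite inE => /predU1P [->|/IH //]; exists x. Qed.

Section Input.

Variables (T : nat) (data : lot_data T) (D : domains (var T)).
Hypothesis D_ne : forall x, D x != fset0.

Let w := encode_input data D.
Let W := nth 0 w.

Let data_block (t : 'I_T) := [:: unit_cost data t; holding_cost data t;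
  setup_cost data t; demand data t; prod_min data t; prod_max data t;
  stock_min data t; stock_max data t].
Let dom_block (x : var T) := size (elements (D x)) :: elements (D x).

Lemma size_data_values : size (data_values data) = T * 8.
Proof.
rewrite (@size_flatten_const _ 8) 1?size_map ?size_enum_ord //.
by move=> s /mapP [t _ ->].
Qed.

Lemma input_field (t : 'I_T) j : j < 8 ->
  field W j.+1 t = nth 0 (data_block t) j.
Proof.
move=> lt_j; rewrite /field /W /w /encode_input addnS /= /data_values.
set ss := [seq _ | t <- enum 'I_T].
have nthE : nth [::] ss t = data_block t.
  by rewrite (nth_map t) ?size_enum_ord // nth_ord_enum.
have -> : t * 8 = size (flatten (take t ss)).
  rewrite (@size_flatten_const _ 8) ?size_take 1?size_map ?size_enum_ord ?ltn_ord //.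
  by move=> s /mem_take /mapP [u _ ->].
by rewrite nth_block ?nthE // size_map size_enum_ord.
Qed.

Lemma input_fields (t : 'I_T) :
  [/\ field W 1 t = unit_cost data t, field W 2 t = holding_cost data t,
      field W 3 t = setup_cost data t & field W 4 t = demand data t] /\
  [/\ field W 5 t = prod_min data t, field W 6 t = prod_max data t,
      field W 7 t = stock_min data t & field W 8 t = stock_max data t].
Proof. by split; split; rewrite input_field. Qed.

Let blocks := [seq dom_block x | x <- all_vars T].

Lemma input_block x j : j <= size (elements (D x)) ->
  W (T * 8 + 1 + size (flatten (take (vidx x) blocks)) + j) = nth 0 (dom_block x) j.
Proof.
move=> le_j; have lt_x : vidx x < size blocks.
  by rewrite size_map size_all_vars vidx_lt.
have nthE : nth [::] blocks (vidx x) = dom_block x.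
  rewrite (nth_map VC) ?size_all_vars ?vidx_lt //.
  by have := vidxK x; rewrite /nth_var => ->.
rewrite /W /w /encode_input addn1 !addSn /= -addnA nth_cat size_data_values.
rewrite ltnNge leq_addr /= addKn -[encode_domains D]cats0.
by rewrite nth_block ?nthE.
Qed.

(** Each jump is by the length of a block, which the first entry of the block gives. *)
Lemma input_posn (x : nat) : x <= nvars T ->
  posn W x = T * 8 + 1 + size (flatten (take x blocks)).
Proof.
rewrite /posn; elim: x => [|x IH] lt_x; first by rewrite take0 addn0.
rewrite /= IH ?(ltnW lt_x) //.
have lt_s : x < size blocks by rewrite size_map size_all_vars.
have := input_block (x := nth_var T x) (leq0n _).
rewrite nth_varK // addn0 => -> /=.
rewrite (take_nth [::] lt_s) flatten_rcons size_cat.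
rewrite (nth_map VC) ?size_all_vars //= -/(nth_var T x); lia.
Qed.

Lemma input_listed (x : var T) :
  W (posn W (vidx x)) = size (elements (D x)) /\
  forall v, listed W (vidx x) v = (v \in D x).
Proof.
have le_x := ltnW (vidx_lt x).
have W_size : W (posn W (vidx x)) = size (elements (D x)).
  by rewrite input_posn // -[LHS](congr1 W (addn0 _)) input_block.
split=> // v; rewrite /listed W_size -mem_elements.
have WE k : k < size (elements (D x)) ->
    W (posn W (vidx x) + 1 + k) = nth 0 (elements (D x)) k.
  by move=> lt_k; rewrite input_posn // -addnA add1n input_block.
apply/hasP/(nthP 0) => [[k]|[k lt_k <-]].
  by rewrite mem_iota => lt_k /eqP <-; exists k; rewrite ?WE.
by exists k; rewrite ?mem_iota // WE.
Qed.

Lemma size_elements_gt0 x : 0 < size (elements (D x)).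
Proof.
by have /fset0Pn [v] := D_ne x; rewrite -mem_elements; case: (elements _).
Qed.

Lemma mem_input_dom x v : v \in dom_block x -> v \in w.
Proof.
move=> xv; rewrite /w /encode_input inE mem_cat; apply/orP; right.
apply/orP; right; apply/flattenP; exists (dom_block x) => //.
exact: map_mem_all_vars.
Qed.

Lemma D_lt_weight x v : v \in D x -> v < weight w.
Proof.
by move=> Dv; apply/weight_gt/(mem_input_dom (x := x)); rewrite inE mem_elements Dv orbT.
Qed.

(** Non-empty domains have blocks of at least two entries; this makes [b] larger than
    the number of variables and than the constants of the program. *)
Lemma size_input_ge : T * 8 + 1 + (nvars T).*2 <= size w.
Proof.
rewrite /w /encode_input /= size_cat size_data_values addn1 addSn ltnS leq_add2l.
rewrite -size_all_vars /encode_domains; elim: (all_vars T) => //= x s IH.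
by rewrite size_cat; have := size_elements_gt0 x; lia.
Qed.

Let m := T + max_value data D + 1.

Lemma value_le_max v :
  v \in data_values data ++ domain_values D -> v <= max_value data D.
Proof. by move=> vals; rewrite /max_value (big_rem v) //= leq_maxl. Qed.

Lemma dom_value_le_max x v : v \in D x -> v <= max_value data D.
Proof.
move=> Dv; apply: value_le_max; rewrite mem_cat; apply/orP; right.
apply/flattenP; exists (elements (D x)); last by rewrite mem_elements.
exact: (map_mem_all_vars (fun x => elements (D x))).
Qed.

Lemma size_elements_le x : size (elements (D x)) <= (max_value data D).+1.
Proof.
rewrite -(size_iota 0 (max_value data D).+1); apply: uniq_leq_size.
  by rewrite sort_uniq fset_uniq.
by move=> v; rewrite mem_elements mem_iota add0n ltnS; apply: dom_value_le_max.
Qed.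

Lemma input_le v : v \in w -> v <= m.
Proof.
rewrite /w /encode_input inE mem_cat => /predU1P [->|/orP [dv|]].
- by rewrite /m; lia.
- by have := value_le_max (v := v); rewrite mem_cat dv /m => /(_ isT); lia.
case/flattenP => s /mem_map_inv [x ->]; rewrite inE => /predU1P [->|xv].
  by have := size_elements_le x; rewrite /m; lia.
by rewrite mem_elements in xv; have := dom_value_le_max xv; rewrite /m; lia.
Qed.

Lemma size_input_le : size w <= 17 * m ^ 2.
Proof.
rewrite /w /encode_input /= size_cat size_data_values.
have : size (encode_domains D) <= nvars T * (m + 1).
  rewrite -size_all_vars /encode_domains; elim: (all_vars T) => //= x s IH.
  by rewrite size_cat; have := size_elements_le x; rewrite /m; lia.
by rewrite /nvars /m !expnS expn0; nia.
Qed.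

Lemma weight_input_le : weight w <= 34 * m ^ 3.
Proof.
apply: (leq_trans (weight_le input_le)).
apply: (leq_trans (leq_mul size_input_le (leqnn _))).
by rewrite [m ^ 3]expnSr; have : 0 < m; rewrite /m; nia.
Qed.

End Input.

Lemma pow5_weight_poly : exists c, forall T (data : lot_data T) D,
  (weight (encode_input data D) ^ 5).+1 <= c * (T + max_value data D + 1) ^ 15.
Proof.
exists (34 ^ 5 + 1) => T data D; set m := _ + _ + 1.
have le5 : weight (encode_input data D) ^ 5 <= (34 * m ^ 3) ^ 5.
  by rewrite leq_exp2r // weight_input_le.
rewrite mulnDl mul1n -addn1 leq_add ?expn_gt0 /m ?addn1 //.
by apply: leq_trans le5 _; rewrite expnMn -expnM /m addn1.
Qed.

(** * Bound consistency of LotSizing in pseudo-polynomial time *)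

Theorem theorem2 :
  exists (algo : cmd) (a k : nat),
  forall (T : nat) (data : lot_data T) (D : domains (var T)),
    (forall x : var T, D x != fset0) ->
    (forall t : 'I_T, D (VY t) `<=` [fset 0; 1]) ->
    exists r : option (domains (var T)),
      achieves_BC (LotSizing data) D r /\
      computes_within algo (encode_input data D) (encode_result r)
        (a * (T + max_value data D + 1) ^ k).
Proof.
have [a [k cost_le]] := wcost_poly algorithm.
have [c pow_le] := pow5_weight_poly.
exists algorithm, (a * c ^ k), (15 * k) => T data D D_ne _.
set w := encode_input data D; set b := weight w; set N := b ^ 5.
pose A0 := arrays (input_state w).
have size_ge := size_input_ge data D_ne; rewrite -/w in size_ge.
have le_wb : size w <= b := size_weight w.
have b_gt8 : 8 < b by move: size_ge; rewrite /nvars; lia.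
have le_bN : b <= N by rewrite -{1}(expn1 b) leq_pexp2l //; lia.
have lt_Tb : T < b by apply: weight_gt; rewrite mem_head.
have le_nb : nvars T <= b by lia.
have D_lt x v : v \in D x -> v < b by apply: D_lt_weight.
have W_dom x : A0 0 (posn (A0 0) (vidx x)) <= N /\
    forall v, listed (A0 0) (vidx x) v = (v \in D x).
  have [W_size W_list] := input_listed data D x; split=> //.
  rewrite [X in X <= _]W_size; apply: leq_trans le_bN; apply/ltnW/weight_gt.
  by apply: (mem_input_dom data (x := x)); rewrite mem_head.
have W_field := input_fields data D.
pose B := cden N (CFor (XVar N) (fun _ => p_sweep (XVar N) (XVar b))) A0.
have [] := @rounds_result T data D N b (A0 0) b_gt8 le_bN erefl lt_Tb le_nb
  erefl W_field W_dom A0.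
  by split=> //; apply: encloses_start.
rewrite -/B => -[B0 B5 encB] resB.
have [s [n [ex_n le_n out_s]]] :=
  @algorithm_steps N w (leq_trans le_wb le_bN) le_bN (leqnn N).
have time : n <= a * c ^ k * (T + max_value data D + 1) ^ (15 * k).
  apply: (leq_trans le_n); apply: (leq_trans (cost_le _)).
  rewrite -mulnA leq_mul2l expnM -expnMn; apply/orP; right.
  by case: (k) => // k'; rewrite leq_exp2r // pow_le.
case: resB => [stB | emptyB].
  exists (Some (trim D b (B 3) (B 4))); split.
    exact: stable_achieves_BC encB stB.
  exists s, n; split=> //; rewrite out_s.
  apply: (output_some b_gt8 le_bN le_nb D_lt erefl W_dom B0 B5) => x.
  have [[_ [v [bv _ _]]] _] := stB x.
  by have [] := bv x; lia.
exists None; split; first exact: empty_achieves_BC encB emptyB.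
exists s, n; split=> //; rewrite out_s.
exact: (output_none b_gt8 le_bN le_nb erefl W_dom B0 B5 emptyB).
Qed.
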